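(* Let $(\mathbf{C},I)$ be a state-separated $\sigma$-effectus with scalars $\mathbf{C}(I,I)\cong[0,1]$ such that the substates $\mathrm{St}_{\le}(A)$ are cancellative for all $A\in\mathbf{C}$. Then there is a faithful morphism of $\sigma$-effectuses $G\colon\mathbf{C}\to\boldsymbol{\sigma}\mathbf{BBNS}$. Furthermore, $\mathrm{St}_{\le}(A)\cong B_{\le}(GA)$ (as $\sigma$-weight $[0,1]$-modules) for all $A\in\mathbf{C}$.
   Context: Countable means finite (possibly empty) or countably infinite. A partial commutative monoid (PCM) is a set $X$ with $0\in X$ and a partial binary operation $\oplus$ with $(x\oplus y)\oplus z=x\oplus(y\oplus z)$, $x\oplus y=y\oplus x$, $0\oplus x=x$, where ''$=$'' is Kleene equality (if either side is defined, so is the other, and they are equal); $x\perp y$ means $x\oplus y$ is defined. A PCM is cancellative if $x\oplus y=x\oplus z$ implies $y=z$. An effect algebra is a PCM $E$ with an element $1\in E$ such that for each $a\in E$ there is a unique $a^{\perp}\in E$ with $a\oplus a^{\perp}=1$, and $a\perp 1$ implies $a=0$; it is partially ordered by $a\le b$ iff $a\oplus c=b$ for some $c$. A $\sigma$-PAM is a nonempty set $M$ with a partial operation $\bigoplus$ sending countable families $(x_j)_{j\in J}$ in $M$ to elements of $M$ (a family is summable if its sum is defined), such that: (partition-associativity) for each countable family $(x_j)_{j\in J}$ and countable partition $J=\biguplus_{k\in K}J_k$, the family is summable iff each $(x_j)_{j\in J_k}$ is summable and $(\bigoplus_{j\in J_k}x_j)_{k\in K}$ is summable, and then $\bigoplus_{j\in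 J}x_j=\bigoplus_{k\in K}\bigoplus_{j\in J_k}x_j$; (unary sum) one-element families are summable with sum their element; (limit) a countable family is summable whenever all its finite subfamilies are. A $\sigma$-PAM is a PCM with $x_1\oplus x_2=\bigoplus_{i\in\{1,2\}}x_i$ and $0=\bigoplus\emptyset$. A map between $\sigma$-PAMs is $\sigma$-additive if it sends summable families to summable families and preserves their sums; $\sigma$-biadditive means $\sigma$-additive in each argument. A $\sigma$-PAC is a category $\mathbf{C}$ with countable coproducts (coprojections $\kappa_i$), all of whose homsets are $\sigma$-PAMs with $\sigma$-biadditive composition (so there are zero morphisms $0_{AB}$), such that: (compatible sum) every compatible countable family $(f_j\colon A\to B)_{j\in J}$ is summable in $\mathbf{C}(A,B)$; (untying) if $f,g\colon A\to B$ are summable then so are $\kappa_1\circ f,\kappa_2\circ g\colon A\to B+B$. Here $(f_j\colon A\to B_j)_{j\in J}$ is compatible if there is $f\colon A\to\coprod_{j}B_j$ with $\triangleright_j\circ f=f_j$ for all $j$, where the partial projection $\triangleright_i\colon\coprod_jB_j\to B_i$ is determined by $\triangleright_i\circ\kappa_i=\mathrm{id}$ and $\triangleright_i\circ\kappa_k=0$ for $k\ne i$. A $\sigma$-effectus is a $\sigma$-PAC $\mathbf{C}$ with a distinguished object $I$ such that: (i) for each $A$, the PCM $\mathbf{C}(A,I)$ is an effect algebra, with top written $\mathbf{1}_A$; (ii) $\mathbf{1}_B\circ f=0_{AI}$ implies $f=0_{AB}$ for all $f\colon A\to B$; (iii) $\mathbf{1}_B\circ f\perp\mathbf{1}_B\circ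 g$ implies $f\perp g$ for all $f,g\colon A\to B$. A morphism of $\sigma$-effectuses $(\mathbf{C},I_{\mathbf{C}})\to(\mathbf{D},I_{\mathbf{D}})$ is a functor $F\colon\mathbf{C}\to\mathbf{D}$ that preserves countable coproducts and for which there is an isomorphism $u\colon I_{\mathbf{D}}\to FI_{\mathbf{C}}$ with $F\mathbf{1}_A=u\circ\mathbf{1}_{FA}$ for each $A\in\mathbf{C}$; it is called faithful if it is faithful as a functor. A substate on $A$ is a morphism $\omega\colon I\to A$, and $\mathrm{St}_{\le}(A)=\mathbf{C}(I,A)$; a state is a substate with $\mathbf{1}_A\circ\omega=\mathbf{1}_I$. The $\sigma$-effectus is state-separated if for any $f,g\colon A\to B$ one has $f=g$ whenever $f\circ\omega=g\circ\omega$ for all states $\omega$ on $A$. The scalars $\mathbf{C}(I,I)$ form an effect monoid (an effect algebra with an associative, unital (with unit $1$), biadditive total multiplication) under composition, and $\mathbf{C}(I,I)\cong[0,1]$ means isomorphism of effect monoids, $[0,1]$ having ordinary multiplication and addition defined when the sum is $\le1$. A $\sigma$-weight $[0,1]$-module is a $\sigma$-PAM $X$ with a $\sigma$-biadditive monoid action $[0,1]\times X\to X$ and a $\sigma$-additive map $|-|\colon X\to[0,1]$ with $|rx|=r|x|$, such that $|x|=0$ implies $x=0$, and a countable family $(x_j)_j$ is summable whenever $(|x_j|)_j$ is summable in $[0,1]$ (i.e. $\sum_j|x_j|\le1$). Isomorphisms are bijections preserving and reflecting all this structure. $\mathrm{St}_{\le}(A)$ is a $\sigma$-weight $[0,1]$-module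 with $r\cdot\omega=\omega\circ r$ and $|\omega|=\mathbf{1}_A\circ\omega$ (identifying scalars with $[0,1]$). An ordered vector space with trace is an ordered real vector space $V$ with $V=V_+-V_+$ and a linear functional $\tau\colon V\to\mathbb{R}$ such that $x>0$ implies $\tau(x)>0$. Its subbase is $B_{\le}(V)=\{x\in V_+\mid\tau(x)\le1\}$. Its intrinsic seminorm is $\|x\|=\inf\{\tau(x_1)+\tau(x_2)\mid x_1,x_2\in V_+,\ x=x_1-x_2\}$. It is a Banach pre-base-norm space if this is a norm and $V$ is complete. It has a $\sigma$-closed subbase if for each $(x_n)_{n\in\mathbb{N}}$ in $B_{\le}(V)$ with $\sum_n\tau(x_n)\le1$, the series $\sum_nx_n$ converges to an element of $B_{\le}(V)$. $\boldsymbol{\sigma}\mathbf{BBNS}$ is the category of Banach pre-base-norm spaces with a $\sigma$-closed subbase and positive linear maps $f\colon V\to W$ that are trace-decreasing ($\tau_W(f(x))\le\tau_V(x)$ for $x\in V_+$). For such $V$, $B_{\le}(V)$ is a $\sigma$-weight $[0,1]$-module with weight $\tau$, a countable family being summable iff its traces sum to at most $1$, and sums given by convergent series. $\boldsymbol{\sigma}\mathbf{BBNS}$ is a $\sigma$-effectus with unit object $(\mathbb{R},\mathrm{id})$ and $\mathbf{1}_V=\tau_V$; a countable family $f_j\colon V\to W$ is summable iff $\sum_j\tau_W(f_j(x))\le\tau_V(x)$ for all $x\in V_+$. *)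

(* Defs.v *)
From mathcomp Require Import all_boot all_order all_algebra finmap.
From mathcomp Require Import all_classical all_reals all_analysis.
From mathcomp Require Import lra.

Set Implicit Arguments.
Unset Strict Implicit.
Unset Printing Implicit Defensive.

Import Order.TTheory GRing.Theory Num.Theory.
Import numFieldNormedType.Exports.

Local Open Scope classical_set_scope.
Local Open Scope ring_scope.

(* Countable index sets are [countType]s, which may be finite or empty.  The
   partial operation is given by its graph: [psum x s] reads "the family x is
   summable with sum s".  The distinguished [pzero], which is the empty sum by
   [psum_empty] below, also witnesses nonemptiness. *)
Record sum_structure (T : Type) := SumStructure {
  psum : forall J : countType, (J -> T) -> T -> Prop;
  pzero : T }.

Section Sums.
Variables (T : Type) (M : sum_structure T).

Definition psummable (J : countType) (x : J -> T) := exists s, psum M x s.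

(* The two-element index set {1, 2} is [bool], with 1 = true and 2 = false. *)
Definition pair_family (x y : T) (b : bool) : T := if b then x else y.
Definition padd (x y s : T) := psum M (pair_family x y) s.
Definition perp (x y : T) := exists s, padd x y s.

(* The cells of a partition J = (+)_k J_k, possibly empty, are the fibres of a
   map p : J -> K.  The existential over y packages both the equivalence of
   summability and the equality of the sums. *)
Record is_sigmaPAM : Prop := IsSigmaPAM {
  psum_uniq : forall (J : countType) (x : J -> T) s s',
    psum M x s -> psum M x s' -> s = s';
  psum_partition : forall (J K : countType) (p : J -> K) (x : J -> T) s,
    psum M x s <->
    exists y : K -> T,
      (forall k, psum M (fun j : {j : J | p j == k} => x (val j)) (y k)) /\
      psum M y s;
  psum_unary : forall (J : countType) (x : J -> T) (j0 : J),
    (forall j, j = j0) -> psum M x (x j0);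
  psum_limit : forall (J : countType) (x : J -> T),
    (forall F : {fset J}, psummable (fun j : {j : J | j \in F} => x (val j))) ->
    psummable x;
  psum_empty : psum M (of_void T) (pzero M) }.

Record is_PCM : Prop := IsPCM {
  padd_uniq : forall x y s s', padd x y s -> padd x y s' -> s = s';
  padd_assoc : forall x y z s,
    (exists2 t, padd x y t & padd t z s) <->
    (exists2 t, padd y z t & padd x t s);
  padd_comm : forall x y s, padd x y s <-> padd y x s;
  padd_zero : forall x, padd (pzero M) x x }.

Definition cancellative := forall x y z s, padd x y s -> padd x z s -> y = z.

Record is_effect_algebra (one : T) : Prop := IsEffectAlgebra {
  ea_PCM : is_PCM;
  ea_orthosupplement : forall a, exists! a', padd a a' one;
  ea_zero_one : forall a, perp a one -> a = pzero M }.

End Sums.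

Definition sigma_additive (T U : Type) (M : sum_structure T)
    (N : sum_structure U) (f : T -> U) :=
  forall (J : countType) (x : J -> T) s, psum M x s -> psum N (f \o x) (f s).

Record category := Category {
  obj :> Type;
  hom : obj -> obj -> Type;
  idc : forall A, hom A A;
  ccomp : forall A B C, hom B C -> hom A B -> hom A C;
  comp_idl : forall A B (f : hom A B), ccomp (idc B) f = f;
  comp_idr : forall A B (f : hom A B), ccomp f (idc A) = f;
  comp_assoc : forall A B C D (h : hom C D) (g : hom B C) (f : hom A B),
    ccomp h (ccomp g f) = ccomp (ccomp h g) f }.

Arguments idc {c} A.
Arguments ccomp {c A B C} g f.
Notation "g \oc f" := (ccomp g f) (at level 40, left associativity).

Definition is_iso (C : category) (A B : C) (f : hom A B) :=
  exists2 g : hom B A, g \oc f = idc A & f \oc g = idc B.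

Record functor (C D : category) := Functor {
  fobj :> C -> D;
  fmap : forall A B, hom A B -> hom (fobj A) (fobj B);
  fmap_id : forall A, fmap (idc A) = idc (fobj A);
  fmap_comp : forall A B E (g : hom B E) (f : hom A B),
    fmap (g \oc f) = fmap g \oc fmap f }.

Arguments fmap {C D} _ {A B} _.

Definition faithful (C D : category) (F : functor C D) :=
  forall (A B : C) (f g : hom A B), fmap F f = fmap F g -> f = g.

Definition is_coproduct (C : category) (J : countType) (B : J -> C) (S : C)
    (kappa : forall j, hom (B j) S) :=
  forall (X : C) (f : forall j, hom (B j) X),
    exists! h : hom S X, forall j, h \oc kappa j = f j.

Definition has_countable_coproducts (C : category) :=
  forall (J : countType) (B : J -> C),
    exists (S : C) (kappa : forall j, hom (B j) S), is_coproduct kappa.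

Definition preserves_countable_coproducts (C D : category)
    (F : functor C D) :=
  forall (J : countType) (B : J -> C) (S : C) (kappa : forall j, hom (B j) S),
    is_coproduct kappa ->
    is_coproduct (B := fun j => F (B j)) (fun j => fmap F (kappa j)).

(* The data of a sigma-effectus; the axioms are in [is_sigma_effectus].  The
   morphisms refer to the data only. *)
Record effectus_structure := EffectusStructure {
  ecat :> category;
  hom_sums : forall A B : ecat, sum_structure (hom A B);
  eunit : ecat;
  truth : forall A : ecat, hom A eunit }.

Arguments hom_sums {e} A B.
Arguments eunit {e}.
Arguments truth {e} A.

Definition zero_mor (C : effectus_structure) (A B : C) : hom A B :=
  pzero (hom_sums A B).

Definition is_partial_projections (C : effectus_structure) (J : countType)
    (B : J -> C) (S : C) (kappa : forall j, hom (B j) S)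
    (tri : forall j, hom S (B j)) :=
  (forall i, tri i \oc kappa i = idc (B i)) /\
  (forall i k, k <> i -> tri i \oc kappa k = zero_mor (B k) (B i)).

Definition compatible (C : effectus_structure) (J : countType) (A : C)
    (B : J -> C) (f : forall j, hom A (B j)) :=
  exists (S : C) (kappa : forall j, hom (B j) S) (tri : forall j, hom S (B j)),
    [/\ is_coproduct kappa, is_partial_projections kappa tri
      & exists h : hom A S, forall j, tri j \oc h = f j].

Record is_sigmaPAC (C : effectus_structure) : Prop := IsSigmaPAC {
  pac_coproducts : has_countable_coproducts C;
  pac_sigmaPAM : forall A B : C, is_sigmaPAM (hom_sums A B);
  pac_compl : forall (A B E : C) (g : hom B E),
    sigma_additive (hom_sums A B) (hom_sums A E) (fun f => g \oc f);
  pac_compr : forall (A B E : C) (f : hom A B),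
    sigma_additive (hom_sums B E) (hom_sums A E) (fun g => g \oc f);
  pac_compatible_sum : forall (J : countType) (A B : C) (f : J -> hom A B),
    compatible (B := fun=> B) f -> psummable (hom_sums A B) f;
  pac_untying : forall (A B S : C) (kappa : bool -> hom B S) (f g : hom A B),
    is_coproduct (B := fun=> B) kappa ->
    perp (hom_sums A B) f g ->
    perp (hom_sums A S) (kappa true \oc f) (kappa false \oc g) }.

Record is_sigma_effectus (C : effectus_structure) : Prop := IsSigmaEffectus {
  eff_PAC : is_sigmaPAC C;
  eff_effect_algebra : forall A : C,
    is_effect_algebra (hom_sums A eunit) (truth A);
  eff_zero : forall (A B : C) (f : hom A B),
    truth B \oc f = zero_mor A eunit -> f = zero_mor A B;
  eff_perp : forall (A B : C) (f g : hom A B),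
    perp (hom_sums A eunit) (truth B \oc f) (truth B \oc g) ->
    perp (hom_sums A B) f g }.

Definition is_effectus_morphism (C D : effectus_structure)
    (F : functor C D) :=
  preserves_countable_coproducts F /\
  exists u : hom (@eunit D) (F (@eunit C)),
    is_iso u /\ forall A : C, fmap F (truth A) = u \oc truth (F A).

Definition is_state (C : effectus_structure) (A : C) (omega : hom eunit A) :=
  truth A \oc omega = truth eunit.

Definition state_separated (C : effectus_structure) :=
  forall (A B : C) (f g : hom A B),
    (forall omega : hom eunit A, is_state omega ->
      f \oc omega = g \oc omega) -> f = g.

Definition I01 (R : realType) := {r : R | 0 <= r <= 1}.

(* Isomorphism of effect monoids.  In [0,1] a sum is defined iff it is at most
   1, so [to01_add] preserves and reflects both definedness and value. *)
Record scalar_iso (R : realType) (C : effectus_structure) := ScalarIso {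
  to01 : hom (@eunit C) eunit -> I01 R;
  of01 : I01 R -> hom (@eunit C) eunit;
  to01K : cancel to01 of01;
  of01K : cancel of01 to01;
  to01_add : forall a b c,
    padd (hom_sums eunit eunit) a b c <->
    val (to01 a) + val (to01 b) = val (to01 c);
  to01_one : val (to01 (truth eunit)) = 1;
  to01_mul : forall a b, val (to01 (a \oc b)) = val (to01 a) * val (to01 b) }.

(* The data of a sigma-weight [0,1]-module, which is what an isomorphism
   preserves and reflects. *)
Record weight_structure (R : realType) (T : Type) := WeightStructure {
  wsums : sum_structure T;
  wact : I01 R -> T -> T;
  weight : T -> I01 R }.

Definition weight_iso (R : realType) (T U : Type) (X : weight_structure R T)
    (Y : weight_structure R U) :=
  exists h : T -> U,
    [/\ bijective h,
        forall (J : countType) (x : J -> T) s,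
          psum (wsums X) x s <-> psum (wsums Y) (h \o x) (h s),
        forall r x, h (wact X r x) = wact Y r (h x)
      & forall x, weight Y (h x) = weight X x].

Definition substates (R : realType) (C : effectus_structure)
    (phi : scalar_iso R C) (A : C) : weight_structure R (hom eunit A) :=
  {| wsums := hom_sums eunit A;
     wact := fun r omega => omega \oc of01 phi r;
     weight := fun omega => to01 phi (truth A \oc omega) |}.

Record traced_space (R : realType) := TracedSpace {
  tcarrier :> lmodType R;
  tle : tcarrier -> tcarrier -> Prop;
  trace : {linear tcarrier -> R^o};
  tle_refl : forall x, tle x x;
  tle_anti : forall x y, tle x y -> tle y x -> x = y;
  tle_trans : forall x y z, tle x y -> tle y z -> tle x z;
  tle_add : forall x y z, tle x y -> tle (x + z) (y + z);
  tle_scale : forall (r : R) x y, 0 <= r -> tle x y -> tle (r *: x) (r *: y);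
  tgenerating : forall x, exists y z, [/\ tle 0 y, tle 0 z & x = y - z];
  trace_gt0 : forall x, tle 0 x -> x <> 0 -> 0 < trace x }.

Arguments trace {R t}.

Section Traced.
Variables (R : realType) (V : traced_space R).

Definition pcone : set V := [set x | tle 0 x].

Definition subbase : set V := [set x | pcone x /\ trace x <= 1].

Definition inorm (x : V) : R :=
  inf [set r | exists y z,
    [/\ pcone y, pcone z, x = y - z & r = trace y + trace z]].

Definition icvg (u : nat -> V) (l : V) :=
  forall e : R, 0 < e -> exists N, forall n, (N <= n)%N -> inorm (u n - l) < e.

Definition icauchy (u : nat -> V) :=
  forall e : R, 0 < e -> exists N, forall m n,
    (N <= m)%N -> (N <= n)%N -> inorm (u m - u n) < e.

(* [inorm] is always a seminorm, so it is a norm iff it separates points. *)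
Definition banach_pre_base_norm :=
  (forall x, inorm x = 0 -> x = 0) /\
  (forall u, icauchy u -> exists l, icvg u l).

Definition sigma_closed_subbase :=
  forall x : nat -> V, (forall n, subbase (x n)) ->
    (\sum_(0 <= n <oo) (trace (x n))%:E <= 1)%E ->
    exists2 s, subbase s & icvg (fun n => \sum_(0 <= k < n) x k) s.

(* Convergence of the net of finite partial sums; for families in the cone
   with summable traces it agrees with convergence of the series along any
   enumeration of J. *)
Definition vsum (J : countType) (x : J -> V) (s : V) :=
  forall e : R, 0 < e -> exists F0 : {fset J}, forall F : {fset J},
    (F0 `<=` F)%fset -> inorm (\sum_(j <- F) x j - s) < e.

End Traced.

Arguments pcone {R} V.
Arguments subbase {R} V.

Record sBBNS_obj (R : realType) := SBBNSObj {
  bbns_space :> traced_space R;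
  bbns_banach : banach_pre_base_norm bbns_space;
  bbns_closed : sigma_closed_subbase bbns_space }.

Record sBBNS_hom (R : realType) (V W : traced_space R) := SBBNSHom {
  bbns_fun :> {linear V -> W};
  bbns_pos : forall x, pcone V x -> pcone W (bbns_fun x);
  bbns_decr : forall x, pcone V x -> trace (bbns_fun x) <= trace x }.

Section SBBNSCategory.
Variable R : realType.
Implicit Types U V W : traced_space R.

Lemma sBBNS_homP V W (f g : sBBNS_hom V W) : (forall x, f x = g x) -> f = g.
Proof.
case: f => [[f fm] fp fd]; case: g => [[g gm] gp gd] /= fg.
have E : f = g by apply: funext.
case: g / E gm gp gd fg => gm gp gd _.
have E : fm = gm.
  case: fm gm {fp fd gp gd} => [[fa] [fs]] [[ga] [gs]].
  by rewrite (Prop_irrelevance fa ga) (Prop_irrelevance fs gs).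
by case: gm / E gp gd => gp gd; congr SBBNSHom; exact: Prop_irrelevance.
Qed.

Program Definition sBBNS_id V : sBBNS_hom V V := @SBBNSHom R V V idfun _ _.
Next Obligation. by []. Qed.
Next Obligation. by []. Qed.

Program Definition sBBNS_comp U V W (g : sBBNS_hom V W) (f : sBBNS_hom U V) :
  sBBNS_hom U W := @SBBNSHom R U W (g \o f) _ _.
Next Obligation. by move=> U V W g f x x0; do 2 apply: bbns_pos. Qed.
Next Obligation.
move=> U V W g f x x0.
by apply: le_trans (bbns_decr f x0); apply/bbns_decr/bbns_pos.
Qed.

Lemma pcone0 V : pcone V 0. Proof. exact: tle_refl. Qed.

Lemma trace_ge0 V (x : V) : pcone V x -> 0 <= trace x.
Proof.
move=> x0; case: (EM (x = 0)) => [->|nx0]; first by rewrite linear0.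
exact/ltW/trace_gt0.
Qed.

Program Definition sBBNS_zero V W : sBBNS_hom V W := @SBBNSHom R V W \0 _ _.
Next Obligation. by move=> V W x x0; exact: pcone0. Qed.
Next Obligation. by move=> V W x x0; rewrite /= linear0 trace_ge0. Qed.

End SBBNSCategory.

Section RealLine.
Variable R : realType.

Program Definition real_traced : traced_space R :=
  @TracedSpace R R^o (fun x y : R => x <= y) idfun _ _ _ _ _ _ _.
Next Obligation. exact: lexx. Qed.
Next Obligation. by move=> x y xy yx; apply/eqP; rewrite eq_le xy. Qed.
Next Obligation. by move=> x y z; exact: le_trans. Qed.
Next Obligation. by move=> x y z xy; exact: (lerD xy (lexx (z : R))). Qed.
Next Obligation. by move=> r x y r0 xy; exact: ler_wpM2l. Qed.
Next Obligation.
move=> x; exists (`|x|), (`|x| - x : R); split => //.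
- by rewrite subr_ge0 ler_norm.
- by rewrite opprB addrC subrK.
Qed.
Next Obligation. by move=> x x0 /eqP nx0; rewrite lt_neqAle eq_sym nx0. Qed.

Lemma real_inorm (x : real_traced) : inorm x = `|x : R|.
Proof.
rewrite /inorm; set S := [set r | _].
have lb r : S r -> `|x : R| <= r.
  move=> [y [z [y0 z0 -> ->]]].
  by rewrite (le_trans (ler_normB _ _))// !ger0_norm.
have Sx : S `|x : R|.
  exists (Num.max (x : R) 0), (Num.max (- (x : R)) 0); split => /=.
  - by rewrite /pcone/= le_max lexx orbT.
  - by rewrite /pcone/= le_max lexx orbT.
  - by rewrite /Num.max; case: ifP; case: ifP; lra.
  - rewrite /Num.max; case: ifP; case: ifP; case: (ger0P (x : R)); lra.
apply/eqP; rewrite eq_le; apply/andP; split.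
  by apply: ge_inf => //; exists `|x : R| => r /lb.
by apply: lb_le_inf; [exists `|x : R| | move=> r /lb].
Qed.

Lemma real_icvg (u : nat -> R) (l : R) :
  u @ \oo --> l -> @icvg R real_traced u l.
Proof.
move=> /cvgrPdist_lt ul e e0; have [N _ H] := ul e e0.
by exists N => n Nn; rewrite real_inorm distrC; exact: H.
Qed.

Lemma real_banach : banach_pre_base_norm real_traced.
Proof.
split=> [x|u uc]; first by rewrite real_inorm => /normr0P/eqP.
have /cvg_ex[l ul] : cvgn (u : nat -> R).
  apply: cauchy_cvg; apply: cauchy_exP => e e0.
  have [N HN] := uc e e0.
  exists (u N : R); exists N => // n /= Nn.
  by rewrite /ball/= -(real_inorm (_ - _)); exact: HN.
by exists l; exact: real_icvg.
Qed.

Lemma real_closed : sigma_closed_subbase real_traced.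
Proof.
move=> x xB sx.
have x0 n : 0 <= (x n : R) by have [] := xB n.
have ub n : \sum_(0 <= k < n) (x k : R) <= 1.
  rewrite -lee_fin -sumEFin; apply: le_trans sx.
  by apply: nneseries_lim_ge => k _ _; rewrite lee_fin x0.
have nd : nondecreasing_seq (fun n => \sum_(0 <= k < n) (x k : R)).
  by apply/nondecreasing_seqP => n; rewrite big_nat_recr//= lerDl.
have /cvg_ex[l cl] : cvgn (fun n => \sum_(0 <= k < n) (x k : R)).
  by apply: nondecreasing_is_cvgn => //; exists 1 => _ [n _ <-].
exists l; last exact: real_icvg.
have le1 : l <= 1.
  rewrite -(cvg_lim _ cl)//; apply: limr_le; first by apply/cvg_ex; exists l.
  by apply: nearW.
split => //=; rewrite /pcone/= -(cvg_lim _ cl)//.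
apply: limr_ge; first by apply/cvg_ex; exists l.
by apply: nearW => n; exact: sumr_ge0.
Qed.

Definition real_sBBNS : sBBNS_obj R := SBBNSObj real_banach real_closed.

End RealLine.

Section SBBNS.
Variable R : realType.
Implicit Types V W : sBBNS_obj R.

Program Definition sBBNS_cat : category :=
  @Category (sBBNS_obj R) (fun V W => sBBNS_hom V W)
    (fun V => sBBNS_id V) (fun U V W g f => sBBNS_comp g f) _ _ _.
Next Obligation. by move=> V W f; exact: sBBNS_homP. Qed.
Next Obligation. by move=> V W f; exact: sBBNS_homP. Qed.
Next Obligation. by move=> U V W X h g f; exact: sBBNS_homP. Qed.

Definition sBBNS_sums V W : sum_structure (sBBNS_hom V W) :=
  {| psum := fun J (f : J -> sBBNS_hom V W) (s : sBBNS_hom V W) =>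
       forall x : V, pcone V x ->
         (\esum_(j in [set: J]) (trace (f j x))%:E <= (trace x)%:E)%E /\
         vsum (fun j => f j x) (s x);
     pzero := sBBNS_zero V W |}.

Program Definition sBBNS_truth V : sBBNS_hom V (real_sBBNS R) :=
  @SBBNSHom R V (real_traced R) (@trace R V) _ _.
Next Obligation. by move=> V x; exact: trace_ge0. Qed.
Next Obligation. by move=> V x _; exact: lexx. Qed.

Definition sBBNS : effectus_structure :=
  {| ecat := sBBNS_cat;
     hom_sums := sBBNS_sums;
     eunit := real_sBBNS R : sBBNS_cat;
     truth := sBBNS_truth |}.

End SBBNS.

Section Subbase.
Variables (R : realType) (V : traced_space R).

Lemma subbase0 : subbase V 0.
Proof. by split; [exact: pcone0 | rewrite linear0 ler01]. Qed.

Definition subbase_sums : sum_structure (subbase V) :=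
  {| psum := fun J (x : J -> subbase V) s =>
       (\esum_(j in [set: J]) (trace (val (x j)))%:E <= 1)%E /\
       vsum (fun j => val (x j)) (val s);
     pzero := exist _ 0 (mem_set subbase0) |}.

Lemma subbase_scale (r : I01 R) (x : subbase V) :
  subbase V (val r *: val x).
Proof.
case: r x => [r /= /andP[r0 r1]] [x /= /set_mem[x0 x1]]; split.
  by rewrite /pcone/= -(scaler0 _ r); exact: tle_scale.
by rewrite linearZ/=; apply: mulr_ile1 => //; exact: trace_ge0.
Qed.

Lemma subbase_trace (x : subbase V) : 0 <= trace (val x) <= 1.
Proof.
by case: x => [x /= /set_mem[x0 ->]]; rewrite trace_ge0.
Qed.

Definition subbase_module : weight_structure R (subbase V) :=
  {| wsums := subbase_sums;
     wact := fun r x => exist _ (val r *: val x) (mem_set (subbase_scale r x));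
     weight := fun x => exist _ (trace (val x)) (subbase_trace x) |}.

End Subbase.

Arguments subbase_module {R} V.

(* Main.v *)
(* Every element of the cone over a substate space is a positive multiple of a
   substate of weight 1, and by cancellativity this cone embeds in its
   Grothendieck group, an ordered vector space with trace whose subbase is the
   space of substates.  The limit axiom forces the weight of a countable sum to
   be the sum of the weights, so that sums of substates converge in the
   intrinsic seminorm; cancelling countable sums shows that it is a norm.
   Post-composition with a morphism extends linearly to these spaces.
   Coproducts are preserved because [id = sum_j kappa_j tri_j]: a map out of the
   image of a coproduct is given on a substate [omega] by a convergent sum over
   the components [tri_j omega]. *)

From HB Require Import structures.
From mathcomp Require Import all_boot all_order all_algebra finmap.
From mathcomp Require Import all_classical all_reals all_analysis.
From mathcomp Require Import generic_quotient ring lra.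
Require Import Defs.

Set Implicit Arguments.
Unset Strict Implicit.
Unset Printing Implicit Defensive.

Import Order.TTheory GRing.Theory Num.Theory.
Import numFieldNormedType.Exports.

Local Open Scope classical_set_scope.
Local Open Scope ring_scope.

(** * Partial sums in sigma-PAMs *)

(** Three obstacles shape the proof. First, [scalar_iso] compares only binary sums, so it does not
    tell that a countable sum of scalars is the real series; countable additivity of weights has to
    be won from the limit axiom. Second, scalars stop at 1, so a substate cannot be divided by its
    weight directly. It is scaled by 1 / (n * weight), which is at most 1 for large n, and n copies
    of the result are added. Third, addition of substates is partial. Once cone elements are stored
    as a mass and a normalised direction, adding masses a and b takes the combination of the
    directions with coefficients a / (a + b) and b / (a + b), and this is always defined. On the
    target side, completeness comes from the sigma-closed subbase alone: a Cauchy sequence is split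
    into two positive series of small trace. *)

Section SigmaPAM.
Variables (T : Type) (M : sum_structure T) (HM : is_sigmaPAM M).
Local Notation "0" := (pzero M).

(** An empty index set is partitioned into no cells at all, so the partition axiom compares it with
    [void]. *)
Lemma psum_void (J : countType) (x : J -> T) : (J -> False) -> psum M x 0.
Proof.
move=> J0; apply/(psum_partition HM (fun j : J => False_rect void (J0 j))).
by exists (of_void T); split; [case | exact: psum_empty].
Qed.

(** Reindexing and padding with zeros in one statement: the fibres of an injection have at most one
    element, so [y k] is the sum over the fibre of [k] and the partition axiom applies. *)
Lemma psum_inj (J K : countType) (f : J -> K) (y : K -> T) s :
  injective f -> (forall k, (forall j, f j <> k) -> y k = 0) ->
  psum M (y \o f) s <-> psum M y s.
Proof.
move=> fI y0.
have fib k : psum M (fun j : {j : J | f j == k} => (y \o f) (val j)) (y k).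
  have [[j <-]|nk] := EM (exists j, f j = k).
    pose j0 : {i | f i == f j} := exist _ j (eqxx _).
    apply: (psum_unary HM (fun i : {i | f i == f j} => y (f (val i))) (j0 := j0)).
    by move=> -[i ij]; apply/val_inj/fI/eqP.
  rewrite y0; last by move=> j jk; apply: nk; exists j.
  by apply: psum_void => -[j /= /eqP jk]; apply: nk; exists j.
split=> [/(psum_partition HM f)[z [zf]]|ys].
  suff -> : z = y by [].
  by apply: funext => k; exact: psum_uniq (zf k) (fib k).
by apply/(psum_partition HM f); exists y.
Qed.

Lemma psum_single (J : countType) (x : J -> T) i :
  (forall j, j <> i -> x j = 0) -> psum M x (x i).
Proof.
move=> x0; apply/(@psum_inj unit _ (fun=> i)).
- by move=> [] [].
- by move=> k /(_ tt) /nesym/x0.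
- by apply: (psum_unary HM (fun=> x i) (j0 := tt)) => -[].
Qed.

Lemma psum_prod (J K : countType) (F : J -> K -> T) s :
  psum M (fun p : J * K => F p.1 p.2) s <->
  exists2 y, forall j, psum M (F j) (y j) & psum M y s.
Proof.
have fib j t : psum M (F j) t <->
    psum M (fun p : {p : J * K | p.1 == j} => F (val p).1 (val p).2) t.
  apply: (@psum_inj _ _ (fun k => exist (fun p : J * K => p.1 == j) (j, k) (eqxx j))
    (fun p => F (val p).1 (val p).2)).
    by move=> k l [].
  move=> [[i k] /= e] nk; case: (nk k); apply: val_inj => /=.
  by rewrite (eqP e).
split=> [/(psum_partition HM fst)[y [yf ys]]|[y yf ys]].
  by exists y => // j; apply/fib.
by apply/(psum_partition HM fst); exists y; split=> // j; apply/fib.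
Qed.

(** Rows against columns of a matrix. With [bool] as one or both index types it yields the binary
    laws below; with ['I_m] it compares copies of a family. *)
Lemma psum_exchange (J K : countType) (F : J -> K -> T) s :
  (exists2 y, forall j, psum M (F j) (y j) & psum M y s) <->
  (exists2 z, forall k, psum M (F^~ k) (z k) & psum M z s).
Proof.
rewrite -psum_prod -(psum_prod (fun k j => F j k)).
apply: (@psum_inj _ _ (fun p : J * K => (p.2, p.1)) (fun p : K * J => F p.2 p.1)).
  by move=> [a b] [c d] [-> ->].
by move=> [k j] /(_ (j, k)).
Qed.

Lemma psum_bool (x : bool -> T) s : psum M x s <-> padd M (x true) (x false) s.
Proof.
rewrite /padd; suff -> : pair_family (x true) (x false) = x by [].
by apply: funext => -[].
Qed.

Lemma paddC x y s : padd M x y s <-> padd M y x s.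
Proof.
rewrite /padd -(@psum_inj _ _ negb (pair_family y x)).
- suff -> : pair_family x y = pair_family y x \o negb by [].
  by apply: funext => -[].
- by move=> [] [].
- by move=> [] H; [case: (H false) | case: (H true)].
Qed.

Lemma padd0 x : padd M x 0 x.
Proof. by apply: (@psum_single _ (pair_family x 0) true) => -[]. Qed.

Lemma padd0_eq x s : padd M x 0 s -> s = x.
Proof. by move=> h; exact: psum_uniq h (padd0 x). Qed.

Lemma padd_ACA x y z t s :
  (exists a b, [/\ padd M x y a, padd M z t b & padd M a b s]) ->
  (exists a b, [/\ padd M x z a, padd M y t b & padd M a b s]).
Proof.
move=> [a [b [xy zt ab]]].
have [H _] := @psum_exchange bool bool
  (fun i j => if i then pair_family x y j else pair_family z t j) s.
case: H => [|u].
  by exists (pair_family a b) => // -[]; rewrite psum_bool.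
move=> uP /psum_bool us; exists (u true), (u false).
by split=> //; [have := uP true | have := uP false]; rewrite psum_bool.
Qed.

Lemma padd_AC x y z t s :
  padd M x y t -> padd M t z s -> exists2 u, padd M y z u & padd M x u s.
Proof.
move=> xy tz; have [|a [b [yz /padd0_eq -> ab]]] := @padd_ACA y x z 0 s.
  by exists t, z; split=> //; [exact/paddC | exact: padd0].
by exists a => //; exact/paddC.
Qed.

Lemma psum_padd (J : countType) (x y : J -> T) a b s :
  psum M x a -> psum M y b -> padd M a b s ->
  exists2 z, forall j, padd M (x j) (y j) (z j) & psum M z s.
Proof.
move=> xa yb ab.
have [H _] := psum_exchange (fun i j => if i then x j else y j) s.
case: H => [|z zP zs].
  by exists (pair_family a b) => // -[].
by exists z => // j; have := zP j; rewrite psum_bool.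
Qed.

(** A subfamily is extended by zero instead of being restricted to a subtype, so that all
    subfamilies share one index type and can be added termwise. *)
Definition cut (J : Type) (P : pred J) (x : J -> T) j := if P j then x j else 0.

(** Exchange for the matrix whose two rows are the cuts of [x] along [P] and its complement: in each
    column one entry is zero, so the column sums are [x]. *)
Lemma psum_cut (J : countType) (P : pred J) (x : J -> T) s :
  psum M x s <-> exists a b,
    [/\ psum M (cut P x) a, psum M (cut (predC P) x) b & padd M a b s].
Proof.
have [E1 E2] := psum_exchange (fun i => if i then cut P x else cut (predC P) x) s.
have col j : padd M (cut P x j) (cut (predC P) x j) (x j).
  by rewrite /cut /=; case: (P j) => /=; [|apply/paddC]; exact: padd0.
split=> [xs|[a [b [xa xb ab]]]].
  have [|y yP /psum_bool ys] := E2; first by exists x => // j; rewrite psum_bool.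
  by exists (y true), (y false); split=> //; [have := yP true | have := yP false].
have [|z zP zs] := E1; first by exists (pair_family a b) => // -[].
suff <- : z = x by [].
apply: funext => j; have := zP j; rewrite psum_bool => zj.
exact: psum_uniq zj (col j).
Qed.

Lemma psum_sub (J : countType) (P : pred J) (x : J -> T) s :
  psum M (fun j : {j : J | P j} => x (val j)) s <-> psum M (cut P x) s.
Proof.
rewrite -(@psum_inj {j : J | P j} _ val (cut P x)).
- suff -> : (fun j : {j : J | P j} => x (val j)) = cut P x \o val by [].
  by apply: funext => -[j Pj] /=; rewrite /cut Pj.
- exact: val_inj.
- move=> j nj; rewrite /cut; case: ifP => // Pj.
  by case: (nj (exist _ j Pj)).
Qed.

Lemma psum_limit_cut (J : countType) (x : J -> T) :
  (forall F : {fset J}, psummable M (cut (mem F) x)) -> psummable M x.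
Proof.
move=> H; apply: (psum_limit HM) => F.
by have [s xs] := H F; exists s; apply/(psum_sub (mem F)).
Qed.

End SigmaPAM.

(** * Countable additivity of weights *)

Lemma big_fsetU_cond (V : nmodType) (J : choiceType) (A B : {fset J}) (f : J -> V) :
  \sum_(j <- (A `|` B)%fset) f j =
  \sum_(j <- A) f j + \sum_(j <- B | j \notin A) f j.
Proof.
rewrite (@big_fsetID _ _ _ _ (mem A)) (@big_fset_condE _ _ _ _ B (fun j => j \notin A)).
congr (_ + _); apply: eq_fbigl => j; by rewrite !inE /=; case: (j \in A); case: (j \in B).
Qed.

Section FiniteSums.
Variables (T : Type) (M : sum_structure T) (HM : is_sigmaPAM M).

Lemma psum_nil (J : countType) (x : J -> T) : psum M (cut M (mem [::]) x) (pzero M).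
Proof.
suff -> : cut M (mem [::]) x = (fun=> pzero M).
  apply/(@psum_inj _ _ HM void J (of_void J)); [by case | by [] |].
  exact: psum_void.
by apply: funext.
Qed.

Lemma psum_cons (J : countType) (x : J -> T) i (l : seq J) s : i \notin l ->
  psum M (cut M (mem (i :: l)) x) s <->
  exists2 t, psum M (cut M (mem l) x) t & padd M (x i) t s.
Proof.
move=> il.
have E1 : psum M (cut M (pred1 i) (cut M (mem (i :: l)) x)) (x i).
  have -> : x i = cut M (pred1 i) (cut M (mem (i :: l)) x) i.
    by rewrite /cut; rewrite /= eqxx inE eqxx.
  by apply: (psum_single HM) => j /eqP/negbTE ji; rewrite /cut /= ji.
have E2 : cut M (predC (pred1 i)) (cut M (mem (i :: l)) x) = cut M (mem l) x.
  apply: funext => j; rewrite /cut /= inE; case: eqVneq => //= ->.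
  by rewrite (negbTE il).
split=> [/(psum_cut HM (pred1 i))[a [b []]]|[t xt it]].
  rewrite E2 => /(psum_uniq HM E1) <- xb ib; by exists b.
by apply/(psum_cut HM (pred1 i)); exists (x i), t; rewrite E2.
Qed.

End FiniteSums.

Section Weight.
Variables (R : realType) (T : Type) (M : sum_structure T) (HM : is_sigmaPAM M).
Variable w : T -> R.
Hypothesis w_ge0 : forall x, 0 <= w x.
Hypothesis w_le1 : forall x, w x <= 1.
Hypothesis w_add : forall x y z, padd M x y z -> w z = w x + w y.
Hypothesis w_perp : forall x y, w x + w y <= 1 -> perp M x y.

Lemma weight0 : w (pzero M) = 0.
Proof. have := w_add (padd0 HM (pzero M)); lra. Qed.

Lemma weight_seq (J : countType) (x : J -> T) (l : seq J) s : uniq l ->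
  psum M (cut M (mem l) x) s -> w s = \sum_(j <- l) w (x j).
Proof.
elim: l s => [|i l IH] s /=.
  by move=> _ /(psum_uniq HM (psum_nil HM x)) <-; rewrite big_nil weight0.
move=> /andP[il ul] /(psum_cons HM x _ il)[t xt it].
by rewrite big_cons (w_add it) (IH t).
Qed.

Lemma psummable_seq (J : countType) (x : J -> T) (l : seq J) : uniq l ->
  \sum_(j <- l) w (x j) <= 1 -> psummable M (cut M (mem l) x).
Proof.
elim: l => [|i l IH] /=; first by exists (pzero M); exact: psum_nil.
move=> /andP[il ul]; rewrite big_cons => le1.
have [|t xt] := IH ul; first by have := w_ge0 (x i); lra.
have [|s xs] := @w_perp (x i) t; first by rewrite (weight_seq ul xt).
by exists s; apply/(psum_cons HM) => //; exists t.
Qed.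

Lemma weight_const n (x : T) s : psum M (fun _ : 'I_n => x) s -> w s = n%:R * w x.
Proof.
have <- : cut M (mem (enum 'I_n)) (fun=> x) = (fun=> x).
  by apply: funext => i; rewrite /cut /= mem_enum.
move=> /(weight_seq (enum_uniq _)) ->.
by rewrite big_enum sumr_const card_ord mulr_natl.
Qed.

(** The limit axiom reduces summability to finite subfamilies, whose sums [w_perp] builds one term
    at a time. *)
Lemma psummable_weight (J : countType) (x : J -> T) :
  (forall F : {fset J}, \sum_(j <- F) w (x j) <= 1) -> psummable M x.
Proof.
move=> le1; apply: (psum_limit_cut HM) => F.
exact: psummable_seq (fset_uniq F) (le1 F).
Qed.

Lemma psum_weight_split (J : countType) (x : J -> T) s (F : {fset J}) :
  psum M x s -> exists a r, [/\ psum M (cut M (mem F) x) a,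
    psum M (cut M (predC (mem F)) x) r, padd M a r s
    & w s = \sum_(j <- F) w (x j) + w r].
Proof.
move=> /(psum_cut HM (mem F))[a [r [Fa Fr ar]]]; exists a, r; split=> //.
by rewrite (w_add ar) (weight_seq (fset_uniq F) Fa).
Qed.

Lemma psum_weight_ge (J : countType) (x : J -> T) s (F : {fset J}) :
  psum M x s -> \sum_(j <- F) w (x j) <= w s.
Proof.
by move=> /(psum_weight_split F)[a [r [_ _ _ ->]]]; rewrite lerDl.
Qed.

(* If [w s] exceeded all finite partial sums by [e], the tails of the family
   would have sums of weight at least [e] but arbitrarily small finite partial
   sums, so that arbitrarily many copies of a tail would be summable. *)
Lemma psum_weight_lt (J : countType) (x : J -> T) s (e : R) :
  psum M x s -> 0 < e -> exists F : {fset J}, w s - e < \sum_(j <- F) w (x j).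
Proof.
move=> xs e0; apply: contrapT => /forallNP H.
have {}H (F : {fset J}) : \sum_(j <- F) w (x j) <= w s - e.
  by rewrite leNgt; apply/negP; exact: H.
pose S := [set \sum_(j <- F) w (x j) | F in [set: {fset J}]].
have S0 : has_sup S.
  split; first by exists (\sum_(j <- fset0) w (x j)); exists fset0.
  by exists (w s - e) => _ [F _ <-].
(* Chosen so that [m] copies of an element of weight at least [e] would weigh more than 1. *)
pose m := (Num.truncn e^-1).+1.
have me : 1 < m%:R * e.
  by rewrite -ltr_pdivrMr// div1r truncnS_gt.
have m0 : 0 < m%:R^-1 :> R by rewrite invr_gt0 ltr0n.
have [_ [F0 _ <-] F0S] := sup_adherent m0 S0.
have [a [r [_ tr _ ws]]] := psum_weight_split F0 xs.
have er : e <= w r by have := H F0; lra.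
set y := cut M _ x in tr.
(* Beyond [F0] only the gap to the supremum is left, and it is below 1 / m. *)
have yF (F : {fset J}) : \sum_(j <- F) w (y j) <= m%:R^-1.
  have : \sum_(j <- (F0 `|` F)%fset) w (x j) <= sup S.
    by apply: sup_upper_bound => //; exists (F0 `|` F)%fset.
  suff -> : \sum_(j <- F) w (y j) = \sum_(j <- F | j \notin F0) w (x j).
    by rewrite big_fsetU_cond; lra.
  rewrite [RHS]big_mkcond; apply: eq_bigr => j _.
  by rewrite /y /cut; rewrite /=; case: (j \in F0); rewrite //= weight0.
have colP j : psummable M (fun _ : 'I_m => y j).
  apply: psummable_weight => F.
  rewrite big_uniq ?fset_uniq //= sumr_const.
  apply: (@le_trans _ _ (m%:R * w (y j))).
    by rewrite mulr_natl; apply: ler_wpMn2l => //; rewrite -[leqRHS]card_ord max_card.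
  have := yF [fset j]%fset; rewrite big_seq_fset1.
  by rewrite -ler_pdivlMl ?ltr0n// mulr1.
have [z zP] := choice colP.
have [u zu] : psummable M z.
  apply: psummable_weight => F; under eq_bigr do rewrite (weight_const (zP _)).
  by rewrite -mulr_sumr -ler_pdivlMl ?ltr0n// mulr1.
(* The columns, [m] copies of each [y j], sum to [u]; read by rows, [u] is [m] copies of the tail
   sum [r]. *)
have [_] := psum_exchange HM (fun (i : 'I_m) j => y j) u.
case=> [|v vP vu]; first by exists z.
have E : v = fun=> r by apply: funext => i; exact: psum_uniq (vP i) tr.
rewrite E in vu; have := w_le1 u; rewrite (weight_const vu).
by apply/negP; rewrite -ltNge (lt_le_trans me)// ler_wpM2l.
Qed.

End Weight.

(** * The cone over a weight module *)

(* Only the values of [wscale r] for [0 <= r <= 1] are constrained. *)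
Record wmodule (R : realType) := WModule {
  wcar :> Type;
  wsum : sum_structure wcar;
  wscale : R -> wcar -> wcar;
  wt : wcar -> R;
  wmod_PAM : is_sigmaPAM wsum;
  wmod_canc : cancellative wsum;
  wt_ge0 : forall x, 0 <= wt x;
  wt_le1 : forall x, wt x <= 1;
  wt_add : forall x y z, padd wsum x y z -> wt z = wt x + wt y;
  wt_perp : forall x y, wt x + wt y <= 1 -> perp wsum x y;
  wt_eq0 : forall x, wt x = 0 -> x = pzero wsum;
  wt_scale : forall r x, 0 <= r <= 1 -> wt (wscale r x) = r * wt x;
  wscaleDr : forall r x y z, 0 <= r <= 1 -> padd wsum x y z ->
    padd wsum (wscale r x) (wscale r y) (wscale r z);
  wscaleDl : forall r s x, 0 <= r -> 0 <= s -> r + s <= 1 ->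
    padd wsum (wscale r x) (wscale s x) (wscale (r + s) x);
  wscaleA : forall r s x, 0 <= r <= 1 -> 0 <= s <= 1 ->
    wscale r (wscale s x) = wscale (r * s) x;
  wscale1 : forall x, wscale 1 x = x }.

Section WModuleTheory.
Variables (R : realType) (X : wmodule R).
Implicit Types (x y z : X) (r s : R).
Let HM := wmod_PAM X.
Let M := wsum X.

Definition wzero : X := pzero (wsum X).

(* A junk value is returned when [wt x + wt y > 1]. *)
Definition wadd x y : X :=
  if pselect (perp (wsum X) x y) is left xy then sval (cid xy) else wzero.

Lemma waddP x y : wt x + wt y <= 1 -> padd M x y (wadd x y).
Proof. by move=> /wt_perp xy; rewrite /wadd; case: pselect => // e; case: cid. Qed.

Lemma waddE x y z : padd M x y z -> wadd x y = z.
Proof.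
move=> xyz; have le1 : wt x + wt y <= 1 by rewrite -(wt_add xyz) wt_le1.
by have := psum_uniq HM (waddP le1) xyz.
Qed.

Lemma waddC x y : wadd x y = wadd y x.
Proof.
rewrite {1}/wadd; case: pselect => [xy|nxy].
  by case: cid => z xyz /=; have /waddE-> := (paddC HM _ _ _).1 xyz.
rewrite /wadd; case: pselect => // yx; case: nxy.
by case: yx => z yx; exists z; exact/(paddC HM).
Qed.

Lemma wt0 : wt wzero = 0.
Proof. by apply: (weight0 HM); exact: wt_add. Qed.

Lemma wadd0 x : wadd x wzero = x.
Proof. exact/waddE/(padd0 HM). Qed.

Lemma wt_wadd x y : wt x + wt y <= 1 -> wt (wadd x y) = wt x + wt y.
Proof. by move/waddP/wt_add. Qed.

Lemma waddA x y z : wt x + wt y + wt z <= 1 ->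
  wadd x (wadd y z) = wadd (wadd x y) z.
Proof.
move=> le1; have le2 : wt x + wt y <= 1 by have := wt_ge0 z; lra.
have xy := waddP le2; rewrite -(wt_wadd le2) in le1.
have [u yz xu] := padd_AC HM xy (waddP le1).
by rewrite (waddE yz) (waddE xu).
Qed.

Lemma waddI x y z : wt x + wt y <= 1 -> wt x + wt z <= 1 ->
  wadd x y = wadd x z -> y = z.
Proof.
move=> /waddP xy /waddP xz E; rewrite E in xy.
exact: wmod_canc xy xz.
Qed.

Lemma wscale_wadd r x y : 0 <= r <= 1 -> wt x + wt y <= 1 ->
  wscale r (wadd x y) = wadd (wscale r x) (wscale r y).
Proof. by move=> r01 /waddP/(wscaleDr r01)/waddE. Qed.

Lemma wscaleDlE r s x : 0 <= r -> 0 <= s -> r + s <= 1 ->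
  wscale (r + s) x = wadd (wscale r x) (wscale s x).
Proof. by move=> r0 s0 rs; rewrite (waddE (wscaleDl x r0 s0 rs)). Qed.

Lemma wscale0l x : wscale 0 x = wzero.
Proof. by apply: wt_eq0; rewrite wt_scale ?mul0r// lexx ler01. Qed.

Lemma wscale0r r : 0 <= r <= 1 -> wscale r wzero = wzero.
Proof. by move=> r01; apply: wt_eq0; rewrite wt_scale// wt0 mulr0. Qed.

Lemma wt_comb r s x y : 0 <= r -> 0 <= s -> r + s <= 1 ->
  wt (wscale r x) + wt (wscale s y) <= 1.
Proof.
move=> r0 s0 rs; rewrite !wt_scale ?r0 ?s0/=; [|lra..].
apply: le_trans rs; rewrite lerD// ler_piMr//; exact: wt_le1.
Qed.

(** Replaces multiplication by an integer, which the action of the unit interval lacks. *)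
Definition wcopies n x := iter n (wadd x) wzero.

Lemma wt_wcopies n x : n%:R * wt x <= 1 -> wt (wcopies n x) = n%:R * wt x.
Proof.
elim: n => [|n IH] le1 /=; first by rewrite wt0 mul0r.
move: le1; rewrite -natr1 mulrDl mul1r => le1.
have le2 : n%:R * wt x <= 1 by have := wt_ge0 x; lra.
by rewrite wt_wadd IH// addrC.
Qed.

Lemma wscale_wcopies n r x : 0 <= r <= 1 -> n%:R * wt x <= 1 ->
  wscale r (wcopies n x) = wcopies n (wscale r x).
Proof.
move=> r01; elim: n => [|n IH] le1 /=; first exact: wscale0r.
move: le1; rewrite -natr1 mulrDl mul1r => le1.
have le2 : n%:R * wt x <= 1 by have := wt_ge0 x; lra.
by rewrite wscale_wadd ?IH// wt_wcopies// addrC.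
Qed.

Lemma wcopies_wscale n r x : 0 <= r -> n%:R * r <= 1 ->
  wcopies n (wscale r x) = wscale (n%:R * r) x.
Proof.
move=> r0; elim: n => [|n IH] le1 /=; first by rewrite mul0r wscale0l.
move: le1; rewrite -natr1 mulrDl mul1r => le1.
have nr0 : 0 <= n%:R * r by rewrite mulr_ge0.
by rewrite addrC wscaleDlE ?IH//; lra.
Qed.

Lemma wcopies_div n x : wcopies n.+1 (wscale n.+1%:R^-1 x) = x.
Proof. by rewrite wcopies_wscale ?mulfV ?wscale1 ?invr_ge0// pnatr_eq0. Qed.

Lemma exists_nat_inv r : 0 < r -> exists n, n.+1%:R^-1 <= r.
Proof.
move=> r0; exists (Num.truncn r^-1); rewrite invf_ple ?posrE ?ltr0n//.
exact/ltW/truncnS_gt.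
Qed.

(** As 1 / r is no scalar, the equation is first scaled down from [r] to some 1 / (n + 1) below it;
    then n + 1 copies give back [x] and [y]. *)
Lemma wscaleI r x y : 0 < r <= 1 -> wscale r x = wscale r y -> x = y.
Proof.
move=> /andP[r0 r1] E; have [n nr] := exists_nat_inv r0.
rewrite -(wcopies_div n x) -(wcopies_div n y).
have -> : n.+1%:R^-1 = (n.+1%:R^-1 / r) * r by rewrite divfK// gt_eqF.
have q01 : 0 <= n.+1%:R^-1 / r <= 1.
  by rewrite divr_ge0 ?(ltW r0)//= ler_pdivrMr// mul1r.
have r01 : 0 <= r <= 1 by rewrite (ltW r0).
by rewrite -!(wscaleA _ q01 r01) E.
Qed.

(** Division by the weight: scale by 1 / ((n + 1) * wt x), which is at most 1, then add n + 1
    copies. Writing the new weight as [wt x / wt x] covers weight 0, where it is 0. *)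
Lemma wnormalize x : exists y, wt y = wt x / wt x /\ wscale (wt x) y = x.
Proof.
have [w0|wn0] := eqVneq (wt x) 0.
  exists wzero; rewrite w0 wt0 mul0r; split=> //.
  by rewrite wscale0l (wt_eq0 w0).
have w0 : 0 < wt x by rewrite lt_neqAle eq_sym wn0 wt_ge0.
have [n nw] := exists_nat_inv w0.
have q0 : 0 <= n.+1%:R^-1 / wt x <= 1.
  by rewrite divr_ge0 ?(ltW w0)//= ler_pdivrMr// mul1r.
have n0 : n.+1%:R != 0 :> R by rewrite pnatr_eq0.
have wq : wt (wscale (n.+1%:R^-1 / wt x) x) = n.+1%:R^-1.
  by rewrite wt_scale// divfK.
have le1 : n.+1%:R * wt (wscale (n.+1%:R^-1 / wt x) x) <= 1 by rewrite wq mulfV.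
exists (wcopies n.+1 (wscale (n.+1%:R^-1 / wt x) x)); split.
  by rewrite wt_wcopies// wq !mulfV.
rewrite wscale_wcopies ?wt_ge0 ?wt_le1//.
by rewrite wscaleA ?wt_ge0 ?wt_le1// mulrC divfK// wcopies_div.
Qed.

End WModuleTheory.

(* A nonzero point of the cone over X is a direction of weight 1 together with
   its trace; as 0/0 = 0, the condition also makes the direction at trace 0
   equal to 0. *)
Record cone (R : realType) (X : wmodule R) := Cone {
  mass : R;
  dir : X;
  mass_ge0 : 0 <= mass;
  wt_dir : wt dir = mass / mass }.

HB.instance Definition _ (R : realType) (X : wmodule R) := gen_eqMixin (cone X).
HB.instance Definition _ (R : realType) (X : wmodule R) := gen_choiceMixin (cone X).

Section Cone.
Variables (R : realType) (X : wmodule R).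
Implicit Types k l m : cone X.

Lemma cone_eq k l : mass k = mass l -> dir k = dir l -> k = l.
Proof.
case: k l => [a x a0 xa] [b y b0 yb] /= ab xy; subst.
by congr Cone; exact: Prop_irrelevance.
Qed.

(** True also at 0, since 0 / 0 = 0; this spares the cone computations a case distinction on zero
    masses. *)
Lemma mulr_divrr (a : R) : a * (a / a) = a.
Proof. by have [->|a0] := eqVneq a 0; rewrite ?mul0r// mulfV// mulr1. Qed.

Lemma divrr_le1 (a : R) : a / a <= 1.
Proof. by have [->|a0] := eqVneq a 0; rewrite ?mul0r ?ler01// mulfV. Qed.

Lemma frac_ge0 (a b : R) : 0 <= a -> 0 <= b -> 0 <= a / (a + b).
Proof. by move=> a0 b0; rewrite divr_ge0// addr_ge0. Qed.

(** The direction of a x + b y is the combination of x and y with coefficients a / (a + b) and b /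
    (a + b), whose sum is at most 1; hence [wadd] never returns its junk value here. *)
Lemma cadd_subproof k l :
  wt (wadd (wscale (mass k / (mass k + mass l)) (dir k))
           (wscale (mass l / (mass k + mass l)) (dir l))) =
  (mass k + mass l) / (mass k + mass l).
Proof.
have k0 := mass_ge0 k; have l0 := mass_ge0 l.
have kl0 := frac_ge0 k0 l0; have lk0 := frac_ge0 l0 k0; rewrite addrC in lk0.
have le1 := divrr_le1 (mass k + mass l); rewrite mulrDl in le1.
rewrite wt_wadd ?wt_comb// !wt_scale ?kl0 ?lk0/=; [|lra..].
by rewrite !wt_dir mulrAC mulr_divrr [X in _ + X]mulrAC mulr_divrr mulrDl.
Qed.

Definition cadd k l := Cone (addr_ge0 (mass_ge0 k) (mass_ge0 l)) (cadd_subproof k l).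

Lemma czero_subproof : wt (wzero X) = 0 / 0.
Proof. by rewrite wt0 mul0r. Qed.

Definition czero := Cone (lexx 0) czero_subproof.

Lemma caddC : commutative cadd.
Proof.
move=> k l; apply: cone_eq => /=; first by rewrite addrC.
by rewrite waddC addrC.
Qed.

Lemma frac_mulD (a b c : R) : 0 <= a -> 0 <= b ->
  (a + b) / c * (a / (a + b)) = a / c.
Proof.
move=> a0 b0; have [ab|ab] := eqVneq (a + b) 0; last first.
  by rewrite mulrAC mulrCA mulfV// mulr1.
have -> : a = 0 by lra.
by rewrite !mul0r mulr0.
Qed.

(** Flattens a nested combination. With [c] the total mass it gives associativity of [cadd]; with
    [c] = 1 it gives additivity of [embed]. *)
Lemma wscale_comb (a b c : R) (x y : X) : 0 <= a -> 0 <= b -> 0 <= (a + b) / c <= 1 ->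
  wscale ((a + b) / c) (wadd (wscale (a / (a + b)) x) (wscale (b / (a + b)) y)) =
  wadd (wscale (a / c) x) (wscale (b / c) y).
Proof.
move=> a0 b0 abc.
have ab1 : a / (a + b) + b / (a + b) <= 1 by rewrite -mulrDl divrr_le1.
have af := frac_ge0 a0 b0; have bf := frac_ge0 b0 a0; rewrite [b + a]addrC in bf.
have a01 : 0 <= a / (a + b) <= 1 by lra.
have b01 : 0 <= b / (a + b) <= 1 by lra.
rewrite wscale_wadd ?wt_comb// !wscaleA// frac_mulD//.
by rewrite [a + b]addrC frac_mulD.
Qed.

Lemma caddA : associative cadd.
Proof.
move=> k l m; apply: cone_eq => /=; first by rewrite addrA.
have := mass_ge0 k; have := mass_ge0 l; have := mass_ge0 m.
set a := mass k; set b := mass l; set c := mass m => c0 b0 a0.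
have t1 : a / (a + b + c) + b / (a + b + c) + c / (a + b + c) <= 1.
  by rewrite -!mulrDl divrr_le1.
have t0 : 0 <= a + b + c by rewrite !addr_ge0.
have at0 : 0 <= a / (a + b + c) by rewrite divr_ge0.
have bt0 : 0 <= b / (a + b + c) by rewrite divr_ge0.
have ct0 : 0 <= c / (a + b + c) by rewrite divr_ge0.
rewrite addrA wscale_comb// ?wscale_comb//; [|by rewrite !mulrDl; lra..].
apply: waddA; rewrite !wt_scale ?at0 ?bt0 ?ct0/=; [|lra..].
apply: le_trans t1; rewrite !lerD// ler_piMr// wt_le1//.
Qed.

Lemma cadd0 : left_id czero cadd.
Proof.
move=> k; apply: cone_eq => /=; first by rewrite add0r.
rewrite add0r mul0r wscale0l waddC wadd0.
have [m0|m0] := eqVneq (mass k) 0; last by rewrite mulfV// wscale1.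
have d0 : dir k = wzero X by apply: wt_eq0; rewrite wt_dir m0 mul0r.
by rewrite d0 wscale0r// m0 mul0r lexx ler01.
Qed.

HB.instance Definition _ := GRing.isNmodule.Build (cone X) caddA caddC cadd0.

Lemma mass0 : mass (0 : cone X) = 0. Proof. by []. Qed.

Lemma massD k l : mass (k + l) = mass k + mass l. Proof. by []. Qed.

Lemma mass_eq0 k : mass k = 0 -> k = 0.
Proof.
move=> k0; apply: cone_eq => //=; apply: wt_eq0.
by rewrite wt_dir k0 mul0r.
Qed.

(** Masses cancel in the reals. The summands in [dir k] then agree, so [waddI] cancels them and
    [wscaleI] removes the common factor; that factor is positive unless [m] has mass 0, which is
    treated apart. *)
Lemma coneI k l m : k + l = k + m -> l = m.
Proof.
move=> E; have := congr1 (@mass _ _) E; rewrite !massD => /addrI lm.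
apply: cone_eq => //; have := congr1 (@dir _ _) E; rewrite /= lm.
have [m0 _|m0] := eqVneq (mass m) 0.
  by rewrite (mass_eq0 m0) (mass_eq0 (etrans lm m0)).
have k0 := mass_ge0 k; have m1 := mass_ge0 m.
have mgt0 : 0 < mass m by rewrite lt_neqAle eq_sym m0.
have p0 := frac_ge0 k0 m1; have q0 := frac_ge0 m1 k0.
have pq : mass k / (mass k + mass m) + mass m / (mass k + mass m) <= 1.
  by rewrite -mulrDl divrr_le1.
rewrite [mass m + _]addrC in q0.
move=> /waddI; rewrite !wt_comb// => /(_ isT isT).
apply: wscaleI; rewrite divr_gt0 ?ltr_wpDl//=; lra.
Qed.

Lemma cscale_subproof (r : {nonneg R}) k :
  wt (wscale (r%:num / r%:num) (dir k)) = (r%:num * mass k) / (r%:num * mass k).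
Proof.
rewrite wt_scale ?divrr_le1 ?divr_ge0// wt_dir.
by rewrite mulf_div.
Qed.

(* The factor [r / r] only serves to make [0 *: k] equal to 0. *)
Definition cscale (r : {nonneg R}) k :=
  Cone (mulr_ge0 (ge0 r) (mass_ge0 k)) (cscale_subproof r k).

Lemma cscaleDr r k l : cscale r (k + l) = cscale r k + cscale r l.
Proof.
apply: cone_eq; first by rewrite /= mulrDr.
rewrite /= -mulrDr -!mulf_div.
have [r0|r0] := eqVneq r%:num 0.
  by rewrite r0 !mul0r !wscale0l wadd0.
by rewrite mulfV// !mul1r !wscale1.
Qed.

Lemma cscaleDl r s k : cscale (r%:num + s%:num)%:nng k = cscale r k + cscale s k.
Proof.
apply: cone_eq; first by rewrite /= mulrDl.
have [k0|k0] := eqVneq (mass k) 0.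
  rewrite /= k0 !mulr0 !mul0r !wscale0l wadd0 (mass_eq0 k0) /= wscale0r//.
  by rewrite divrr_le1 divr_ge0.
rewrite /= -mulrDl -!mulf_div mulfV// !mulr1.
have p0 : 0 <= r%:num / (r%:num + s%:num) by rewrite frac_ge0.
have q0 : 0 <= s%:num / (r%:num + s%:num) by rewrite addrC frac_ge0.
have pq : r%:num / (r%:num + s%:num) + s%:num / (r%:num + s%:num) <= 1.
  by rewrite -mulrDl divrr_le1.
have rr01 (t : {nonneg R}) : 0 <= t%:num / t%:num <= 1.
  by rewrite divrr_le1 divr_ge0.
rewrite !wscaleA//; [|lra..].
rewrite mulrAC mulr_divrr [s%:num / _ * _]mulrAC mulr_divrr.
by rewrite mulrDl wscaleDlE.
Qed.

Lemma cscaleA r s k : cscale r (cscale s k) = cscale (r%:num * s%:num)%:nng k.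
Proof.
apply: cone_eq; first by rewrite /= mulrA.
rewrite /= wscaleA ?divrr_le1 ?divr_ge0//.
by rewrite mulf_div.
Qed.

Lemma cscale1 k : cscale 1%:nng k = k.
Proof.
by apply: cone_eq; rewrite /= mul1r ?invr1 ?wscale1.
Qed.

End Cone.

(** * The Grothendieck group of the cone *)

Local Open Scope quotient_scope.

Section Grothendieck.
Variables (R : realType) (X : wmodule R).
Implicit Types (k l m : cone X) (p q : cone X * cone X) (r s : {nonneg R}).

Definition grel p q := p.1 + q.2 == q.1 + p.2.

Lemma grel_refl : reflexive grel.
Proof. by move=> p; exact: eqxx. Qed.

Lemma grel_sym : symmetric grel.
Proof. by move=> p q; rewrite /grel eq_sym. Qed.

(** The relation carries no auxiliary summand, so transitivity rests on cancellation in the cone. *)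
Lemma grel_trans : transitive grel.
Proof.
move=> q p t /eqP pq /eqP qt; apply/eqP/(@coneI _ _ (q.1 + q.2)).
rewrite [LHS](AC (2*2) ((3*2)*(1*4))) [RHS](AC (2*2) ((1*4)*(3*2))) /=.
by rewrite pq qt.
Qed.

Definition gequiv := EquivRel grel grel_refl grel_sym grel_trans.

Definition gspace := {eq_quot gequiv}.
HB.instance Definition _ : EqQuotient _ gequiv gspace := EqQuotient.on gspace.
HB.instance Definition _ := Choice.on gspace.

Definition gdiff k l : gspace := \pi_gspace (k, l).

Lemma gdiffP k l k' l' : gdiff k l = gdiff k' l' <-> k + l' = k' + l.
Proof. by split=> [/eqmodP/eqP|H]; [|apply/eqmodP/eqP]. Qed.

Lemma gdiff_surj v : exists k l, v = gdiff k l.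
Proof. by exists (repr v).1, (repr v).2; rewrite /gdiff -surjective_pairing reprK. Qed.

Definition gadd (u v : gspace) : gspace :=
  gdiff ((repr u).1 + (repr v).1) ((repr u).2 + (repr v).2).

Lemma repr_gdiff k l : (repr (gdiff k l)).1 + l = k + (repr (gdiff k l)).2.
Proof. by apply/gdiffP; rewrite /gdiff -surjective_pairing reprK. Qed.

Lemma gaddE k l k' l' : gadd (gdiff k l) (gdiff k' l') = gdiff (k + k') (l + l').
Proof. by apply/gdiffP; rewrite addrACA !repr_gdiff addrACA. Qed.

Definition gopp (u : gspace) : gspace := gdiff (repr u).2 (repr u).1.

Lemma goppE k l : gopp (gdiff k l) = gdiff l k.
Proof. by apply/gdiffP; rewrite addrC -repr_gdiff addrC. Qed.

Lemma gaddA : associative gadd.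
Proof.
move=> u v w; have [k [l ->]] := gdiff_surj u; have [k' [l' ->]] := gdiff_surj v.
by have [k2 [l2 ->]] := gdiff_surj w; rewrite !gaddE !addrA.
Qed.

Lemma gaddC : commutative gadd.
Proof.
move=> u v; have [k [l ->]] := gdiff_surj u; have [k' [l' ->]] := gdiff_surj v.
by rewrite !gaddE [k + _]addrC [l + _]addrC.
Qed.

Lemma gadd0 : left_id (gdiff 0 0) gadd.
Proof. by move=> u; have [k [l ->]] := gdiff_surj u; rewrite gaddE !add0r. Qed.

Lemma gaddN : left_inverse (gdiff 0 0) gopp gadd.
Proof.
move=> u; have [k [l ->]] := gdiff_surj u; rewrite goppE gaddE.
by apply/gdiffP; rewrite addr0 add0r addrC.
Qed.

HB.instance Definition _ := GRing.isZmodule.Build gspace gaddA gaddC gadd0 gaddN.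

Lemma max0_ge0 (c : R) : 0 <= Num.max c 0.
Proof. by rewrite le_max lexx orbT. Qed.

Definition pos_part (c : R) : {nonneg R} := NngNum (max0_ge0 c).

Definition neg_part (c : R) : {nonneg R} := NngNum (max0_ge0 (- c)).

Lemma pos_neg_part c : c = (pos_part c)%:num - (neg_part c)%:num.
Proof. by rewrite /= /Num.max; case: ifP; case: ifP; lra. Qed.

Lemma nonneg_split (c : R) : exists r s, c = r%:num - s%:num.
Proof. by exists (pos_part c), (neg_part c); exact: pos_neg_part. Qed.

(** Only nonnegative reals act on the cone, so [c] is split into parts p - n and c (k - l) is
    expanded as (p k + n l) - (p l + n k). *)
Definition gscale (c : R) (u : gspace) : gspace :=
  gdiff (cscale (pos_part c) (repr u).1 + cscale (neg_part c) (repr u).2)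
        (cscale (pos_part c) (repr u).2 + cscale (neg_part c) (repr u).1).

Lemma cscaleD_eq r s r' s' k : r%:num + s%:num = r'%:num + s'%:num ->
  cscale r k + cscale s k = cscale r' k + cscale s' k.
Proof. by move=> E; rewrite -!cscaleDl; congr cscale; exact/val_inj. Qed.

(** Independence both of the representative and of the splitting of [c]. The second matters for the
    module laws: the parts of a product or sum of scalars are not the products or sums of their
    parts. *)
Lemma gscaleE (c : R) r s k l : c = r%:num - s%:num ->
  gscale c (gdiff k l) = gdiff (cscale r k + cscale s l) (cscale r l + cscale s k).
Proof.
move=> crs; rewrite /gscale; set p := pos_part c; set n := neg_part c.
have E : p%:num + s%:num = r%:num + n%:num.
  by have := pos_neg_part c; rewrite {1}crs -/p -/n; lra.
set a := (repr _).1; set b := (repr _).2.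
have ab : a + l = k + b := repr_gdiff k l.
transitivity (gdiff (cscale p k + cscale n l) (cscale p l + cscale n k)).
  apply/gdiffP; rewrite [LHS]addrACA [RHS]addrACA -!cscaleDr ab.
  by rewrite [b + k]addrC -ab [l + a]addrC.
apply/gdiffP; rewrite [LHS](AC (2*2) ((1*4)*(2*3))) [RHS](AC (2*2) ((1*4)*(2*3))) /=.
by rewrite (cscaleD_eq k E) (@cscaleD_eq n r s p) // addrC -E addrC.
Qed.

Lemma gscaleA (a b : R) u : gscale a (gscale b u) = gscale (a * b) u.
Proof.
have [k [l ->]] := gdiff_surj u.
have [p [n Ea]] := nonneg_split a; have [p' [n' Eb]] := nonneg_split b.
rewrite (gscaleE k l Eb) (gscaleE _ _ Ea).
rewrite (@gscaleE _ (p%:num * p'%:num + n%:num * n'%:num)%:nng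
  (p%:num * n'%:num + n%:num * p'%:num)%:nng) /=; last first.
  by rewrite Ea Eb; ring.
rewrite !cscaleDr !cscaleA.
have DE (r s r' s' : {nonneg R}) m :
    cscale (r%:num * r'%:num + s%:num * s'%:num)%:nng m =
    cscale (r%:num * r'%:num)%:nng m + cscale (s%:num * s'%:num)%:nng m.
  by rewrite -cscaleDl; congr cscale; exact/val_inj.
by rewrite !DE; congr gdiff; rewrite [LHS](AC (2*2) ((1*4)*(2*3))).
Qed.

Lemma gscale1 u : gscale 1 u = u.
Proof.
have [k [l ->]] := gdiff_surj u; rewrite (@gscaleE _ 1%:nng 0%:nng) /= ?subr0//.
rewrite !cscale1; have c0 m : cscale 0%:nng m = 0 by apply: mass_eq0; rewrite /= mul0r.
by rewrite !c0 !addr0.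
Qed.

Lemma gscaleDr a : {morph gscale a : u v / u + v}.
Proof.
move=> u v; have [k [l ->]] := gdiff_surj u; have [k' [l' ->]] := gdiff_surj v.
have [p [n Ea]] := nonneg_split a.
rewrite [_ + _]gaddE !(gscaleE _ _ Ea) [RHS]gaddE !cscaleDr.
by congr gdiff; exact: addrACA.
Qed.

Lemma gscaleDl u : {morph gscale^~ u : a b / a + b}.
Proof.
move=> a b; have [k [l ->]] := gdiff_surj u.
have [p [n Ea]] := nonneg_split a; have [p' [n' Eb]] := nonneg_split b.
rewrite (gscaleE k l Eb) (gscaleE k l Ea).
rewrite (@gscaleE _ (p%:num + p'%:num)%:nng (n%:num + n'%:num)%:nng) /=; last first.
  by rewrite Ea Eb; ring.
rewrite [RHS]gaddE !cscaleDl.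
by congr gdiff; exact: addrACA.
Qed.

HB.instance Definition _ := GRing.Zmodule_isLmodule.Build R gspace
  gscaleA gscale1 gscaleDr gscaleDl.

Definition gcone k : gspace := gdiff k 0.

Lemma gconeD k l : gcone (k + l) = gcone k + gcone l.
Proof. by rewrite [RHS]gaddE add0r. Qed.

Lemma gconeZ r k : gcone (cscale r k) = r%:num *: gcone k.
Proof.
rewrite [RHS](@gscaleE _ r 0%:nng) /= ?subr0//.
have c0 s : cscale s (0 : cone X) = 0 by apply: mass_eq0; rewrite /= mulr0.
have c1 m : cscale 0%:nng m = 0 by apply: mass_eq0; rewrite /= mul0r.
by rewrite !c0 c1 !addr0.
Qed.

Lemma gcone_inj : injective gcone.
Proof. by move=> k l /gdiffP; rewrite !addr0. Qed.

Lemma gdiffE k l : gdiff k l = gcone k - gcone l.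
Proof. by rewrite [- _]goppE [RHS]gaddE addr0 add0r. Qed.

Definition gle (u v : gspace) := exists k, v - u = gcone k.

Definition gtrace (u : gspace) : R^o := mass (repr u).1 - mass (repr u).2.

Lemma gtraceE k l : gtrace (gdiff k l) = mass k - mass l.
Proof.
by have := congr1 (@mass _ _) (repr_gdiff k l); rewrite !massD /gtrace; lra.
Qed.

Lemma gtrace_linear : linear gtrace.
Proof.
move=> a u v; have [k [l ->]] := gdiff_surj u; have [k' [l' ->]] := gdiff_surj v.
have [p [n Ea]] := nonneg_split a.
rewrite [_ *: _](gscaleE k l Ea) [_ + gdiff _ _]gaddE !gtraceE.
by rewrite !massD /= Ea /GRing.scale /=; ring.
Qed.

HB.instance Definition _ := GRing.isLinear.Build R gspace R^o _ gtrace gtrace_linear.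

Lemma gcone0 : gcone 0 = 0. Proof. by []. Qed.

Lemma gtrace_gcone k : gtrace (gcone k) = mass k.
Proof. by rewrite gtraceE mass0 subr0. Qed.

Lemma gle_refl u : gle u u.
Proof. by exists 0; rewrite subrr. Qed.

Lemma gle_anti u v : gle u v -> gle v u -> u = v.
Proof.
move=> [k vu] [l uv].
have E : gcone (k + l) = gcone 0 by rewrite gconeD -vu -uv addrC subrKA subrr.
have := congr1 (@mass _ _) (gcone_inj E); rewrite massD mass0 => kl0.
have k0 : mass k = 0 by have := mass_ge0 k; have := mass_ge0 l; lra.
by move: vu; rewrite (mass_eq0 k0) gcone0 => /subr0_eq.
Qed.

Lemma gle_trans u v w : gle u v -> gle v w -> gle u w.
Proof.
move=> [k vu] [l wv]; exists (l + k); rewrite gconeD -vu -wv.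
by rewrite addrA subrK.
Qed.

Lemma gle_add u v w : gle u v -> gle (u + w) (v + w).
Proof. by move=> [k vu]; exists k; rewrite opprD addrACA subrr addr0. Qed.

Lemma gle_scale (a : R) u v : 0 <= a -> gle u v -> gle (a *: u) (a *: v).
Proof.
move=> a0 [k vu]; exists (cscale (NngNum a0) k).
by rewrite gconeZ -scalerBr vu.
Qed.

Lemma gle0 u : gle 0 u <-> exists k, u = gcone k.
Proof. by rewrite /gle subr0. Qed.

Lemma ggenerating u : exists v w, [/\ gle 0 v, gle 0 w & u = v - w].
Proof.
have [k [l ->]] := gdiff_surj u; exists (gcone k), (gcone l); split.
- by apply/gle0; exists k.
- by apply/gle0; exists l.
- exact: gdiffE.
Qed.

Lemma gtrace_gt0 u : gle 0 u -> u <> 0 -> 0 < gtrace u.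
Proof.
move=> /gle0[k ->] k0; rewrite gtrace_gcone lt_neqAle mass_ge0 andbT.
by apply/eqP => /esym /mass_eq0 E; apply: k0; rewrite E.
Qed.

Definition wspace : traced_space R :=
  TracedSpace gle_refl gle_anti gle_trans gle_add gle_scale
    ggenerating gtrace_gt0.

End Grothendieck.

(** * Substates as the subbase of the Grothendieck group *)

Section Embedding.
Variables (R : realType) (X : wmodule R).
Implicit Types x y z : X.

Lemma exists_embed x : exists v : wspace X, exists k : cone X,
  [/\ v = gcone k, mass k = wt x & wscale (wt x) (dir k) = x].
Proof.
have [y [yw yx]] := wnormalize x.
by exists (gcone (Cone (wt_ge0 x) yw)), (Cone (wt_ge0 x) yw).
Qed.

Definition embed x : wspace X := sval (cid (exists_embed x)).

Lemma embedP x : exists k : cone X,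
  [/\ embed x = gcone k, mass k = wt x & wscale (wt x) (dir k) = x].
Proof. exact: (svalP (cid (exists_embed x))). Qed.

(** Makes the choice in [embed] canonical: [wscaleI] recovers a direction from its multiple by a
    positive mass, and at mass 0 both points are 0. *)
Lemma cone_dir_eq (k l : cone X) : mass k = mass l -> mass k <= 1 ->
  wscale (mass k) (dir k) = wscale (mass l) (dir l) -> k = l.
Proof.
move=> kl k1; have [k0 _|k0] := eqVneq (mass k) 0.
  by rewrite (mass_eq0 k0) (mass_eq0 (etrans (esym kl) k0)).
rewrite -kl => /wscaleI E; apply: cone_eq => //; apply: E.
by rewrite k1 andbT lt_neqAle eq_sym k0 mass_ge0.
Qed.

Lemma embedE (k : cone X) x : mass k = wt x -> wscale (wt x) (dir k) = x ->
  embed x = gcone k.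
Proof.
have [l [-> lx ldir]] := embedP x => kx kdir; congr gcone.
by apply: cone_dir_eq; rewrite ?lx ?wt_le1// ?ldir ?kx ?kdir.
Qed.

Lemma embed_inj : injective embed.
Proof.
move=> x y; have [k [-> kx <-]] := embedP x; have [l [-> ly <-]] := embedP y.
by move=> /gcone_inj kl; rewrite -kx -ly kl.
Qed.

Lemma trace_embed x : trace (embed x) = wt x.
Proof. by have [k [-> <- _]] := embedP x; exact: gtrace_gcone. Qed.

Lemma embed_cone x : pcone (wspace X) (embed x).
Proof. by have [k [-> _ _]] := embedP x; apply/gle0; exists k. Qed.

Lemma embed_subbase x : subbase (wspace X) (embed x).
Proof. by split; [exact: embed_cone | rewrite trace_embed wt_le1]. Qed.

Lemma embed_surj (v : wspace X) : subbase (wspace X) v -> exists x, embed x = v.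
Proof.
move=> [/gle0[k ->]]; rewrite [trace _]gtrace_gcone => k1.
exists (wscale (mass k) (dir k)).
have E : wt (wscale (mass k) (dir k)) = mass k.
  by rewrite wt_scale ?mass_ge0// wt_dir mulr_divrr.
by apply: embedE; rewrite E.
Qed.

Lemma embedD x y z : padd (wsum X) x y z -> embed z = embed x + embed y.
Proof.
move=> xyz; have [k [-> kx kd]] := embedP x; have [l [-> ly ld]] := embedP y.
rewrite -gconeD; apply: embedE; first by rewrite massD kx ly (wt_add xyz).
have zw := wt_add xyz; have z1 := wt_le1 z.
have zw01 : 0 <= (mass k + mass l) / 1 <= 1.
  by rewrite divr1 kx ly -zw wt_ge0.
(* Here c = 1: scaling by the total mass undoes the normalisation in [cadd]. *)
have := wscale_comb (dir k) (dir l) (mass_ge0 k) (mass_ge0 l) zw01.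
by rewrite !divr1 {1}kx {1}ly -zw => ->; rewrite kx ly kd ld; exact: waddE.
Qed.

Lemma embedZ (r : R) x : 0 <= r <= 1 -> embed (wscale r x) = r *: embed x.
Proof.
move=> r01; have [k [-> kx kd]] := embedP x.
have r0 : 0 <= r by case/andP: r01.
rewrite -[r in RHS]/((NngNum r0)%:num) -gconeZ; apply: embedE.
  by rewrite /= kx wt_scale.
have w01 : 0 <= wt x <= 1 by rewrite wt_ge0 wt_le1.
have rw01 : 0 <= r * wt x <= 1 by rewrite -wt_scale// wt_ge0 wt_le1.
rewrite /= wt_scale// wscaleA ?divrr_le1 ?divr_ge0//.
by rewrite mulrAC mulr_divrr -wscaleA// kd.
Qed.

End Embedding.

Arguments embed {R X} x.

(** * The intrinsic seminorm *)

Section Seminorm.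
Variables (R : realType) (V : traced_space R).
Implicit Types x y z : V.

Lemma pconeD x y : pcone V x -> pcone V y -> pcone V (x + y).
Proof.
move=> x0 y0; apply: tle_trans y0 _.
by have := tle_add y x0; rewrite add0r.
Qed.

Lemma pconeZ (r : R) x : 0 <= r -> pcone V x -> pcone V (r *: x).
Proof. by move=> r0 /(tle_scale r0); rewrite scaler0. Qed.

Lemma pcone_sum (J : Type) (l : seq J) (P : pred J) (x : J -> V) :
  (forall j, pcone V (x j)) -> pcone V (\sum_(j <- l | P j) x j).
Proof. by move=> x0; elim/big_ind: _ => //; [exact: pcone0 | exact: pconeD]. Qed.

Definition inorm_set x := [set r : R | exists y z,
  [/\ pcone V y, pcone V z, x = y - z & r = trace y + trace z]].

Lemma inorm_set_ge0 x r : inorm_set x r -> 0 <= r.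
Proof. by move=> [y [z [y0 z0 _ ->]]]; rewrite addr_ge0// trace_ge0. Qed.

Lemma inorm_has_inf x : has_inf (inorm_set x).
Proof.
split; last by exists 0 => r /inorm_set_ge0.
by have [y [z [y0 z0 E]]] := tgenerating x; exists (trace y + trace z), y, z.
Qed.

Lemma inorm_le x y z : pcone V y -> pcone V z -> x = y - z ->
  inorm x <= trace y + trace z.
Proof.
move=> y0 z0 E; apply: ge_inf; first exact: (inorm_has_inf x).2.
by exists y, z.
Qed.

Lemma inorm_lt x (e : R) : inorm x < e -> exists y z,
  [/\ pcone V y, pcone V z, x = y - z & trace y + trace z < e].
Proof.
move=> xe; have e0 : 0 < e - inorm x by rewrite subr_gt0.
have [_ [y [z [y0 z0 E ->]]]] := inf_adherent e0 (inorm_has_inf x).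
have -> : inf (inorm_set x) = inorm x by [].
by rewrite [X in _ < X]addrC subrK => lte; exists y, z.
Qed.

Lemma inorm_ge0 x : 0 <= inorm x.
Proof. by apply: lb_le_inf; [exact: (inorm_has_inf x).1 | exact: inorm_set_ge0]. Qed.

Lemma inorm0 : inorm (0 : V) = 0.
Proof.
apply/eqP; rewrite eq_le inorm_ge0 andbT.
have := @inorm_le 0 0 0 (pcone0 V) (pcone0 V).
by rewrite subrr linear0 addr0; apply.
Qed.

Lemma inormN x : inorm (- x) = inorm x.
Proof.
have le y : inorm (- y) <= inorm y.
  apply/ler_addgt0Pr => e e0.
  have [|u [v [u0 v0 E uv]]] := @inorm_lt y (inorm y + e); first by rewrite ltrDl.
  have := @inorm_le (- y) v u v0 u0; rewrite E opprB => /(_ erefl).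
  by rewrite E in uv *; lra.
by apply/eqP; rewrite eq_le le/= -[X in inorm X <= _]opprK le.
Qed.

Lemma inormD x y : inorm (x + y) <= inorm x + inorm y.
Proof.
apply/ler_addgt0Pr => e e0; have e2 : 0 < e / 2 by lra.
have [|u [v [u0 v0 xE uv]]] := @inorm_lt x (inorm x + e / 2); first by rewrite ltrDl.
have [|s [t [s0 t0 yE st]]] := @inorm_lt y (inorm y + e / 2); first by rewrite ltrDl.
have := @inorm_le (x + y) (u + s) (v + t) (pconeD u0 s0) (pconeD v0 t0).
by rewrite {1}xE {1}yE opprD addrACA => /(_ erefl); rewrite !linearD /=; lra.
Qed.

Lemma inormB x y : inorm (x - y) = inorm (y - x).
Proof. by rewrite -inormN opprB. Qed.

Lemma inorm_triangle x y z : inorm (x - z) <= inorm (x - y) + inorm (y - z).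
Proof. by rewrite -[x - z](subrKA y) inormD. Qed.

(** With [trace_le_inorm] the two agree on the cone, so remainders of positive series are controlled
    by their traces. *)
Lemma inorm_cone x : pcone V x -> inorm x <= trace x.
Proof.
move=> x0; have := @inorm_le x x 0 x0 (pcone0 V).
by rewrite subr0 linear0 addr0; apply.
Qed.

Lemma trace_le_inorm x : trace x <= inorm x.
Proof.
apply/ler_addgt0Pr => e e0.
have [|y [z [y0 z0 E yz]]] := @inorm_lt x (inorm x + e); first by rewrite ltrDl.
rewrite {1}E linearB /=; have := trace_ge0 z0; lra.
Qed.

Lemma inormZ_le (r : R) x : 0 <= r -> inorm (r *: x) <= r * inorm x.
Proof.
move=> r0; apply/ler_addgt0Pr => e e0.
(* The denominator [r + 1] also serves [r] = 0, and [r] times this tolerance is at most [e]. *)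
have d0 : 0 < e / (r + 1) by rewrite divr_gt0//; lra.
have [|y [z [y0 z0 E yz]]] := @inorm_lt x (inorm x + e / (r + 1)).
  by rewrite ltrDl.
have := @inorm_le (r *: x) _ _ (pconeZ r0 y0) (pconeZ r0 z0).
rewrite {1}E scalerBr => /(_ erefl); rewrite !linearZ /= -mulrDr => le1.
apply: le_trans le1 _; apply: le_trans (ler_wpM2l r0 (ltW yz)) _.
rewrite mulrDr lerD2l mulrCA ler_piMr ?(ltW e0)// ler_pdivrMr; lra.
Qed.

End Seminorm.

Lemma inorm_map (R : realType) (V W : traced_space R) (f : sBBNS_hom V W) x :
  inorm (f x) <= inorm x.
Proof.
apply/ler_addgt0Pr => e e0.
have [|y [z [y0 z0 E yz]]] := @inorm_lt _ _ x (inorm x + e); first by rewrite ltrDl.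
have := @inorm_le _ _ (f x) _ _ (bbns_pos f y0) (bbns_pos f z0).
rewrite {1}E linearB => /(_ erefl).
have := bbns_decr f y0; have := bbns_decr f z0; lra.
Qed.

(** * Unconditional sums in a traced space *)

Section Vsum.
Variables (R : realType) (V : traced_space R).
Implicit Types (x y z : V) (J : countType).

Lemma vsum_uniq J (x : J -> V) s t : (forall v : V, inorm v = 0 -> v = 0) ->
  vsum x s -> vsum x t -> s = t.
Proof.
move=> norm0 xs xt; apply/eqP; rewrite -subr_eq0; apply/eqP/norm0.
apply/eqP; rewrite eq_le inorm_ge0 andbT; apply/ler_addgt0Pr => e e0; rewrite add0r.
have e2 : 0 < e / 2 by lra.
have [F Fs] := xs _ e2; have [G Gt] := xt _ e2.
have := inorm_triangle s (\sum_(j <- (F `|` G)%fset) x j) t.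
rewrite [X in _ <= X + _]inormB.
have := Fs _ (fsubsetUl F G); have := Gt _ (fsubsetUr F G); lra.
Qed.

Lemma vsumD J (x y : J -> V) s t :
  vsum x s -> vsum y t -> vsum (fun j => x j + y j) (s + t).
Proof.
move=> xs yt e e0; have e2 : 0 < e / 2 by lra.
have [F Fs] := xs _ e2; have [G Gt] := yt _ e2.
exists (F `|` G)%fset => H; rewrite fsubUset => /andP[FH GH].
rewrite big_split /= opprD addrACA; apply: le_lt_trans (inormD _ _) _.
have := Fs _ FH; have := Gt _ GH; lra.
Qed.

Lemma vsumZ J (x : J -> V) (r : R) s : 0 <= r ->
  vsum x s -> vsum (fun j => r *: x j) (r *: s).
Proof.
move=> r0 xs e e0; have d0 : 0 < e / (r + 1) by rewrite divr_gt0//; lra.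
have [F Fs] := xs _ d0; exists F => G FG.
rewrite -scaler_sumr -scalerBr; apply: le_lt_trans (inormZ_le _ r0) _.
apply: le_lt_trans (ler_wpM2l r0 (ltW (Fs _ FG))) _.
rewrite mulrCA gtr_pMr// ltr_pdivrMr; lra.
Qed.

Lemma vsum_single J (x : J -> V) i : (forall j, j <> i -> x j = 0) -> vsum x (x i).
Proof.
move=> x0 e e0; exists [fset i]%fset => F; rewrite fsub1set => iF.
rewrite (big_fsetD1 i)//= big1_fset ?addr0 ?subrr ?inorm0// => j.
by rewrite !inE => /andP[/eqP ji _] _; exact: x0.
Qed.

Lemma vsum_trace_le J (x : J -> V) s (c : R) : vsum x s ->
  (forall F : {fset J}, \sum_(j <- F) trace (x j) <= c) -> trace s <= c.
Proof.
move=> xs xc; apply/ler_addgt0Pr => e e0; have [F Fs] := xs _ e0.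
have := trace_le_inorm (s - \sum_(j <- F) x j); rewrite inormB linearB linear_sum /=.
by have := Fs _ (fsubset_refl F); have := xc F; lra.
Qed.

Lemma sum_fset_le J (a : J -> R) (F G : {fset J}) : (forall j, 0 <= a j) ->
  (F `<=` G)%fset -> \sum_(j <- F) a j <= \sum_(j <- G) a j.
Proof.
move=> a0 /fsetUidPr <-; rewrite big_fsetU_cond lerDl; exact: sumr_ge0.
Qed.

Lemma sum_fset_nat (U : nmodType) (a : nat -> U) n :
  \sum_(k <- [fset k in iota 0 n]%fset) a k = \sum_(0 <= k < n) a k.
Proof.
rewrite /index_iota subn0; apply: perm_big; apply: uniq_perm => //=.
- exact: iota_uniq.
- by move=> k; rewrite !inE.
Qed.

Lemma fset_nat_sub (F : {fset nat}) : exists n, (F `<=` [fset k in iota 0 n])%fset.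
Proof.
pose n := (\max_(k <- F) k)%N.+1; exists n; apply/fsubsetP => k kF.
have kn : (k < n)%N.
  by rewrite ltnS; exact: (@leq_bigmax_seq _ (enum_fset F) xpredT id k kF isT).
by move: n kn => n kn; rewrite !inE mem_iota.
Qed.

Lemma vsum_icvg (x : nat -> V) s : vsum x s ->
  icvg (fun n => \sum_(0 <= k < n) x k) s.
Proof.
move=> xs e e0; have [F Fs] := xs _ e0; have [N FN] := fset_nat_sub F.
exists N => n Nn; rewrite -sum_fset_nat; apply: Fs.
apply: fsubset_trans FN _; apply/fsubsetP => k.
by rewrite !inE !mem_iota /= => /leq_trans; exact.
Qed.

End Vsum.

(** * Completeness and the sigma-closed subbase *)

Lemma sum_fset_nat_le (R : realType) (a : nat -> R) (c : R) : (forall k, 0 <= a k) ->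
  (forall n, \sum_(0 <= k < n) a k <= c) -> forall F : {fset nat}, \sum_(k <- F) a k <= c.
Proof.
move=> a0 ac F; have [n Fn] := fset_nat_sub F.
by apply: le_trans (ac n); rewrite -sum_fset_nat; exact: sum_fset_le.
Qed.

Lemma sum_half_le (R : realType) n : \sum_(0 <= k < n) 2^-1 ^+ k.+1 <= 1 :> R.
Proof.
suff -> : \sum_(0 <= k < n) 2^-1 ^+ k.+1 = 1 - 2^-1 ^+ n :> R.
  by rewrite gerBl exprn_ge0// invr_ge0.
elim: n => [|n IH]; first by rewrite big_nil expr0 subrr.
by rewrite big_nat_recr//= IH [2^-1 ^+ n.+1]exprS; field.
Qed.

Lemma esum_le1 (R : realType) (J : countType) (a : J -> R) (c : R) :
  (\esum_(j in [set: J]) (a j)%:E <= c%:E)%E <->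
  forall F : {fset J}, \sum_(j <- F) a j <= c.
Proof.
split=> [le1 F|le1].
  rewrite -lee_fin -sumEFin; apply: le_trans le1.
  apply: ereal_sup_ubound; exists [set` F]; first by split.
  by rewrite fsbig_finite//= set_fsetK.
apply: ge_ereal_sup => _ [A [Afin _] <-].
by rewrite fsbig_finite//= sumEFin lee_fin.
Qed.

Section SigmaClosed.
Variables (R : realType) (V : traced_space R) (HV : sigma_closed_subbase V).

(** Closure of the subbase gives a limit along one enumeration only. Convergence over all finite
    sets follows since, past a set whose trace sum is nearly the supremum, adding further terms
    changes the partial sum by little in norm. *)
Lemma vsum_exists (J : countType) (x : J -> V) : (forall j, pcone V (x j)) ->
  (forall F : {fset J}, \sum_(j <- F) trace (x j) <= 1) ->
  exists2 s, subbase V s & vsum x s.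
Proof.
(* Codes that belong to no element of [J] contribute 0. *)
move=> x0 le1; pose y n := oapp x 0 (@pickle_inv J n).
pose E n := [fset j in pmap (@pickle_inv J) (iota 0 n)]%fset.
have sumE (U : nmodType) (f : J -> U) n :
    \sum_(j <- E n) f j = \sum_(0 <= k < n) oapp f 0 (@pickle_inv J k).
  rewrite -big_pmap /index_iota subn0; apply: perm_big; apply: uniq_perm => //=.
    by apply: (pmap_uniq (@pickle_invK J)); exact: iota_uniq.
  by move=> k; rewrite !inE.
have ty n : trace (y n) = oapp (fun j => trace (x j)) 0 (@pickle_inv J n).
  by rewrite /y; case: pickle_inv => //=; rewrite linear0.
have [||s sV ys] := HV (x := y).
- move=> n; rewrite /subbase /= ty /y; case: pickle_inv => [j|] /=.
    by split=> //; have := le1 [fset j]%fset; rewrite big_seq_fset1.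
  by split; [exact: pcone0 | exact: ler01].
- apply: lime_le.
    apply: is_cvg_nneseries => n _ _; rewrite lee_fin ty.
    by case: pickle_inv => //= j; exact: trace_ge0.
  apply: nearW => n; rewrite sumEFin lee_fin.
  by under eq_bigr do rewrite ty; rewrite -sumE.
exists s => // e e0; have e2 : 0 < e / 2 by lra.
pose S := [set \sum_(j <- F) trace (x j) | F in [set: {fset J}]].
have S0 : has_sup S.
  split; first by exists (\sum_(j <- fset0) trace (x j)); exists fset0.
  by exists 1 => _ [F _ <-].
have [_ [F0 _ <-] F0S] := sup_adherent e2 S0.
exists F0 => F FF0.
have [N Ns] := ys _ e2.
(* Late enough for the enumerated partial sum to be close to [s] and for [E n] to contain [F]. *)
pose n := maxn N (\max_(j <- F) (choice.pickle j).+1)%N.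
have FE : (F `<=` E n)%fset.
  apply/fsubsetP => j jF; rewrite !inE mem_pmap; apply/mapP.
  exists (choice.pickle j); last by rewrite pickleK_inv.
  rewrite mem_iota /= leq_max.
  by rewrite (@leq_bigmax_seq _ (enum_fset F) xpredT
    (fun j => (choice.pickle j).+1) j jF isT) orbT.
have /Ns : (N <= n)%N by rewrite leq_max leqnn.
rewrite -sumE => ns; apply: le_lt_trans (inorm_triangle _ (\sum_(j <- E n) x j) _) _.
have split (U : nmodType) (f : J -> U) :
    \sum_(j <- E n) f j = \sum_(j <- F) f j + \sum_(j <- E n | j \notin F) f j.
  by rewrite -big_fsetU_cond (fsetUidPr _ _ FE).
have tail : inorm (\sum_(j <- F) x j - \sum_(j <- E n) x j) <=
    \sum_(j <- E n | j \notin F) trace (x j).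
  rewrite inormB split addrAC subrr add0r -linear_sum.
  by apply: inorm_cone; exact: pcone_sum.
have : \sum_(j <- E n) trace (x j) <= sup S by apply: sup_upper_bound => //; exists (E n).
rewrite split.
have : \sum_(j <- F0) trace (x j) <= \sum_(j <- F) trace (x j).
  by apply: sum_fset_le => // j; exact: trace_ge0.
lra.
Qed.

(** The increments of a fast subsequence are differences of positive vectors with trace below
    2^-(k+1). Both positive series converge by [vsum_exists], and the subsequence telescopes. *)
Lemma sigma_closed_complete u : @icauchy R V u -> exists l, icvg u l.
Proof.
move=> uc.
have h0 k : 0 < 2^-1 ^+ k.+1 :> R by rewrite exprn_gt0// invr_gt0.
have [N NP] := choice (fun k => uc _ (h0 k)).
(* A strictly increasing sequence of indices that dominates [N]. *)
pose M k := (\sum_(i < k.+1) (N i).+1)%N.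
have MN k : (N k <= M k)%N by rewrite /M big_ord_recr /= addnS ltnW// ltnS leq_addl.
have MS k : (M k < M k.+1)%N by rewrite {2}/M big_ord_recr /= addnS ltnS leq_addr.
have Mk k : (k <= M k)%N by elim: k => // k IH; exact: leq_ltn_trans IH (MS k).
have dP k : exists p : V * V, [/\ pcone V p.1, pcone V p.2,
    u (M k.+1) - u (M k) = p.1 - p.2 & trace p.1 + trace p.2 < 2^-1 ^+ k.+1].
  have /inorm_lt[y [z [y0 z0 E yz]]] : inorm (u (M k.+1) - u (M k)) < 2^-1 ^+ k.+1.
    by apply: NP => //; exact: leq_trans (MN k) (ltnW (MS k)).
  by exists (y, z).
have {dP} [d dP] := choice dP.
have lim (y : nat -> V) : (forall k, pcone V (y k)) ->
    (forall k, trace (y k) <= 2^-1 ^+ k.+1) ->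
    exists s, icvg (fun n => \sum_(0 <= k < n) y k) s.
  move=> y0 yh; have [||s _ /vsum_icvg] := @vsum_exists _ y => //; last by exists s.
  apply: sum_fset_nat_le => [k|n]; first exact: trace_ge0.
  apply: le_trans (sum_half_le R n); exact: ler_sum.
have [||Y yY] := lim (fun k => (d k).1).
- by move=> k; have [] := dP k.
- move=> k; have [_ z0 _ h] := dP k; have := trace_ge0 z0; lra.
have [||Z zZ] := lim (fun k => (d k).2).
- by move=> k; have [] := dP k.
- move=> k; have [y0 _ _ h] := dP k; have := trace_ge0 y0; lra.
exists (u (M 0%N) + (Y - Z)) => e e0; have e3 : 0 < e / 3 by lra.
have [A AP] := uc _ e3; have [B BP] := yY _ e3; have [C CP] := zZ _ e3.
exists A => m Am; pose n := maxn A (maxn B C).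
have An : (A <= M n)%N by apply: leq_trans (Mk n); rewrite leq_max leqnn.
have /BP yn : (B <= n)%N by rewrite !leq_max leqnn orbT.
have /CP zn : (C <= n)%N by rewrite !leq_max leqnn !orbT.
have E : u (M n) = u (M 0%N) +
    (\sum_(0 <= k < n) (d k).1 - \sum_(0 <= k < n) (d k).2).
  rewrite -sumrB (eq_bigr (fun k => u (M k.+1) - u (M k))) => [|k _].
    by rewrite (telescope_sumr (fun k => u (M k)))// addrC subrK.
  by have [_ _ ->] := dP k.
apply: le_lt_trans (inorm_triangle _ (u (M n)) _) _.
have := AP _ _ Am An.
have := inormD (\sum_(0 <= k < n) (d k).1 - Y) (- (\sum_(0 <= k < n) (d k).2 - Z)).
rewrite inormN.
suff -> : u (M n) - (u (M 0%N) + (Y - Z)) =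
  \sum_(0 <= k < n) (d k).1 - Y + - (\sum_(0 <= k < n) (d k).2 - Z) by lra.
by rewrite E opprD addrACA subrr add0r opprD addrACA -opprD.
Qed.

End SigmaClosed.

(** * The space of a weight module is an object of the target category *)

Section WSpace.
Variables (R : realType) (X : wmodule R).
Implicit Types x y z : X.
Let HM := wmod_PAM X.
Let M := wsum X.
Local Notation V := (wspace X).

Lemma embed0 : embed (wzero X) = 0.
Proof.
apply: (addrI (embed (wzero X))); rewrite addr0.
exact/esym/embedD/(padd0 HM).
Qed.

Lemma embed_seq (J : countType) (x : J -> X) (l : seq J) s : uniq l ->
  psum M (cut M (mem l) x) s -> embed s = \sum_(j <- l) embed (x j).
Proof.
elim: l s => [|i l IH] s /=.
  by move=> _ /(psum_uniq HM (psum_nil HM x)) <-; rewrite big_nil; exact: embed0.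
move=> /andP[il ul] /(psum_cons HM x _ il)[t xt it].
by rewrite big_cons (embedD it) (IH t).
Qed.

(** The difference between [embed s] and a finite partial sum is [embed r] for the sum [r] of the
    remaining terms; its norm is at most its weight, which [psum_weight_lt] makes small. *)
Lemma embed_vsum (J : countType) (x : J -> X) s :
  psum M x s -> vsum (embed \o x) (embed s).
Proof.
move=> xs e e0.
have [F0 F0s] := psum_weight_lt HM (@wt_ge0 _ X) (@wt_le1 _ X) (@wt_add _ X)
  (@wt_perp _ X) xs e0.
exists F0 => F FF0.
have [a [r [Fa _ ar ws]]] := psum_weight_split HM (@wt_add _ X) F xs.
rewrite (embedD ar) (embed_seq (fset_uniq F) Fa) opprD addrA subrr add0r inormN.
apply: le_lt_trans (inorm_cone (embed_cone r)) _; rewrite trace_embed.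
have : \sum_(j <- F0) wt (x j) <= \sum_(j <- F) wt (x j).
  by apply: sum_fset_le => // j; exact: wt_ge0.
lra.
Qed.

Lemma wsummable_nat (x : nat -> X) (c : R) : c <= 1 ->
  (forall n, \sum_(0 <= k < n) wt (x k) <= c) -> exists2 s, psum M x s & wt s <= c.
Proof.
move=> c1 xc.
have xF : forall F : {fset nat}, \sum_(k <- F) wt (x k) <= c.
  by apply: sum_fset_nat_le => // k; exact: wt_ge0.
have [|s xs] := psummable_weight HM (@wt_ge0 _ X) (@wt_add _ X) (@wt_perp _ X) (x := x).
  by move=> F; exact: le_trans (xF F) c1.
exists s => //; apply/ler_addgt0Pr => e e0.
have [F Fs] := psum_weight_lt HM (@wt_ge0 _ X) (@wt_le1 _ X) (@wt_add _ X)
  (@wt_perp _ X) xs e0.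
have := xF F; lra.
Qed.

Lemma psum_shift (x : nat -> X) s : psum M x s ->
  exists2 t, psum M (fun k => x k.+1) t & padd M (x 0%N) t s.
Proof.
move=> /(psum_cut HM (pred1 0%N))[a [t [x0 xt at_]]].
have E0 : psum M (cut M (pred1 0%N) x) (x 0%N).
  have -> : x 0%N = cut M (pred1 0%N) x 0%N by [].
  by apply: (psum_single HM) => -[].
exists t; last by rewrite -(psum_uniq HM x0 E0).
apply/(@psum_inj _ _ HM _ _ succn (cut M (predC (pred1 0%N)) x)) => //.
- by move=> m n [].
- by case=> [//|k] /(_ k).
Qed.

(* Differences [a n - b n] of decreasing size with constant value [v] satisfy
   [a n + b (n + 1) = a (n + 1) + b n]; summing over [n] and cancelling the
   shifted sums gives [a 0 = b 0]. *)
Lemma wspace_norm0 (v : V) : inorm v = 0 -> v = 0.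
Proof.
move=> v0.
(* The exponent starts at 2 so that each series has weight at most 1/2 and a sum of [a] can be added
   to a sum of [b]. *)
have h0 k : 0 < 2^-1 ^+ k.+2 :> R by rewrite exprn_gt0// invr_gt0.
have pP k : exists p : X * X,
    v = embed p.1 - embed p.2 /\ wt p.1 + wt p.2 < 2^-1 ^+ k.+2.
  have /inorm_lt[y [z [y0 z0 E yz]]] : inorm v < 2^-1 ^+ k.+2 by rewrite v0.
  have h1 : 2^-1 ^+ k.+2 <= 1 :> R by apply: exprn_ile1; lra.
  have ty := trace_ge0 y0; have tz := trace_ge0 z0.
  have [|a aE] := @embed_surj _ _ y; first by split=> //; lra.
  have [|b bE] := @embed_surj _ _ z; first by split=> //; lra.
  by exists (a, b); rewrite -!trace_embed /= aE bE.
have {pP} [p pP] := choice pP.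
pose a k := (p k).1; pose b k := (p k).2.
have summ (x : nat -> X) : (forall k, wt (x k) <= 2^-1 ^+ k.+2) ->
    exists2 s, psum M x s & wt s <= 2^-1.
  move=> xh; apply: wsummable_nat; first by lra.
  move=> n; have := sum_half_le R n.
  have : \sum_(0 <= k < n) wt (x k) <= 2^-1 * \sum_(0 <= k < n) 2^-1 ^+ k.+1.
    by rewrite mulr_sumr; apply: ler_sum => k _; rewrite -exprS.
  lra.
have [|Y aY Y1] := summ a.
  by move=> k; have [_] := pP k; have := wt_ge0 (p k).2; rewrite /a; lra.
have [|Z bZ Z1] := summ b.
  by move=> k; have [_] := pP k; have := wt_ge0 (p k).1; rewrite /b; lra.
have [Y' aY' YY'] := psum_shift aY; have [Z' bZ' ZZ'] := psum_shift bZ.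
have wY := wt_add YY'; have wZ := wt_add ZZ'.
have wa := wt_ge0 (a 0%N); have wb := wt_ge0 (b 0%N).
have [|S YZ'] := @wt_perp _ X Y Z'; first by lra.
have [|T Y'Z] := @wt_perp _ X Y' Z; first by lra.
have [c cP cS] := psum_padd HM aY bZ' YZ'.
have [d dP dT] := psum_padd HM aY' bZ Y'Z.
have cd : c = d.
  apply: funext => k; apply: embed_inj; rewrite (embedD (cP k)) (embedD (dP k)).
  have [E _] := pP k; have [E' _] := pP k.+1.
  rewrite -/(a _) -/(b _) in E E'.
  apply/eqP; rewrite -[embed (a k)](subrK (embed (b k))) -E.
  by rewrite -[embed (a k.+1)](subrK (embed (b k.+1))) -E' addrAC.
rewrite cd in cS; have := psum_uniq HM cS dT => ST.
have := embedD Y'Z; rewrite -ST (embedD YZ') (embedD YY') (embedD ZZ').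
have [-> _] := pP 0%N; rewrite -/(a _) -/(b _) [RHS]addrCA -addrA.
by move=> /addIr ->; rewrite subrr.
Qed.

Lemma wspace_closed : sigma_closed_subbase V.
Proof.
move=> v vB le1.
have [x xv] := choice (fun n => embed_surj (vB n)).
have [||s xs _] := @wsummable_nat x 1 => //.
  move=> n; rewrite -lee_fin -sumEFin; apply: le_trans le1.
  rewrite (eq_bigr (fun k => (trace (v k))%:E)).
    apply: nneseries_lim_ge => k _ _; rewrite lee_fin.
    by have [/trace_ge0] := vB k.
  by move=> k _; rewrite -xv trace_embed.
exists (embed s); first exact: embed_subbase.
have -> : v = embed \o x by apply: funext => n; rewrite /= xv.
exact/vsum_icvg/embed_vsum.
Qed.

Lemma wspace_banach : banach_pre_base_norm V.
Proof.
split; first exact: wspace_norm0.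
exact: sigma_closed_complete wspace_closed.
Qed.

Definition wspace_sBBNS : sBBNS_obj R := SBBNSObj wspace_banach wspace_closed.

(** For the converse, the trace bound makes [x] summable with some sum [t]; then [embed t] is a
    limit too, and limits are unique because [inorm] is a norm. *)
Lemma psum_embed (J : countType) (x : J -> X) s :
  psum M x s <-> (\esum_(j in [set: J]) (trace (embed (x j)))%:E <= 1)%E /\
                 vsum (embed \o x) (embed s).
Proof.
split=> [xs|[le1 xs]].
  split; last exact: embed_vsum.
  apply/esum_le1 => F; under eq_bigr do rewrite trace_embed.
  apply: le_trans (wt_le1 s).
  exact: (psum_weight_ge HM (@wt_ge0 _ X) (@wt_add _ X) F xs).
have [|t xt] := psummable_weight HM (@wt_ge0 _ X) (@wt_add _ X) (@wt_perp _ X) (x := x).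
  move=> F; move/esum_le1 : le1 => /(_ F).
  by under eq_bigr do rewrite trace_embed.
suff -> : s = t by [].
apply: embed_inj; exact: vsum_uniq wspace_norm0 xs (embed_vsum xt).
Qed.

End WSpace.

(** * Extension of maps from substates *)

Section Extension.
Variables (R : realType) (X : wmodule R).
Local Notation V := (wspace X).

Lemma pcone_embed (v : V) (c : R) : pcone V v -> trace v <= c -> 0 < c ->
  exists x, v = c *: embed x.
Proof.
move=> v0 vc c0; have [|x xv] := @embed_surj _ _ (c^-1 *: v).
  split; first by apply: pconeZ; rewrite // invr_ge0 ltW.
  by rewrite linearZ /= /GRing.scale /= ler_pdivrMl// mulr1.
by exists x; rewrite xv scalerA mulfV ?scale1r// gt_eqF.
Qed.

Lemma wspace_spanned (v : V) : exists c x y, 0 <= c /\ v = c *: (embed x - embed y).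
Proof.
have [p [q [p0 q0 ->]]] := tgenerating v.
have tp := trace_ge0 p0; have tq := trace_ge0 q0.
have [c [c0 pc qc]] : exists c : R, [/\ 0 < c, trace p <= c & trace q <= c].
  (* The added 1 keeps [c] positive when both traces vanish. *)
  by exists (trace p + trace q + 1); split; lra.
have [x ->] := pcone_embed p0 pc c0; have [y ->] := pcone_embed q0 qc c0.
by exists c, x, y; split; [exact: ltW | rewrite scalerBr].
Qed.

Lemma hom_ext (W : traced_space R) (f g : sBBNS_hom V W) :
  (forall x, f (embed x) = g (embed x)) -> f = g.
Proof.
move=> fg; apply: sBBNS_homP => v; have [c [x [y [_ ->]]]] := wspace_spanned v.
by rewrite !linearZ !linearB /= !fg.
Qed.

Section LinearExtension.
Variables (W : lmodType R) (g : X -> W).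
Hypothesis gD : forall x y z, padd (wsum X) x y z -> g z = g x + g y.
Hypothesis gZ : forall r x, 0 <= r <= 1 -> g (wscale r x) = r *: g x.

(** The extension is introduced by its graph because [c], [x] and [y] are not determined by [v]. The
    graph is a linear subspace, so it is functional as soon as 0 is related only to 0, which
    injectivity of [embed] ensures. *)
Definition extends (v : V) (w : W) := exists c x y,
  [/\ 0 <= c, v = c *: (embed x - embed y) & w = c *: (g x - g y)].

Lemma extends_add u v w z : extends u w -> extends v z -> extends (u + v) (w + z).
Proof.
move=> [c [x [y [c0 -> ->]]]] [d [x' [y' [d0 -> ->]]]].
have [cd|cd] := eqVneq (c + d) 0.
  have [-> ->] : c = 0 /\ d = 0 by split; lra.
  by exists 0, x, y; rewrite !scale0r !addr0; split.
have cd0 : 0 < c + d by rewrite lt_neqAle eq_sym cd addr_ge0.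
(* Taking out the factor [c + d] leaves convex coefficients, for which sums in [X] are defined. *)
have p0 : 0 <= c / (c + d) by rewrite divr_ge0// ltW.
have q0 : 0 <= d / (c + d) by rewrite divr_ge0// ltW.
have pq : c / (c + d) + d / (c + d) <= 1 by rewrite -mulrDl mulfV.
have p01 : 0 <= c / (c + d) <= 1 by lra.
have q01 : 0 <= d / (c + d) <= 1 by lra.
have comb (s t : X) := waddP (wt_comb s t p0 q0 pq).
exists (c + d), (wadd (wscale (c / (c + d)) x) (wscale (d / (c + d)) x')),
  (wadd (wscale (c / (c + d)) y) (wscale (d / (c + d)) y')).
rewrite !(embedD (comb _ _)) !(gD (comb _ _)) !embedZ// !gZ//.
split; first exact: ltW.
  rewrite opprD addrACA -!scalerBr [RHS]scalerDr !scalerA.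
  by rewrite ![(c + d) * (_ / _)]mulrC !divfK.
rewrite opprD addrACA -!scalerBr [RHS]scalerDr !scalerA.
by rewrite ![(c + d) * (_ / _)]mulrC !divfK.
Qed.

Lemma extends_scale (a : R) v w : extends v w -> extends (a *: v) (a *: w).
Proof.
move=> [c [x [y [c0 -> ->]]]]; have [a0|a0] := leP 0 a.
  by exists (a * c), x, y; rewrite !scalerA; split=> //; rewrite mulr_ge0.
exists (- a * c), y, x; split; first by rewrite mulr_ge0// oppr_ge0 ltW.
  by rewrite scalerA mulNr scaleNr -scalerN opprB.
by rewrite scalerA mulNr scaleNr -scalerN opprB.
Qed.

Lemma extends0 w : extends 0 w -> w = 0.
Proof.
move=> [c [x [y [c0 /esym/eqP + ->]]]].
rewrite scaler_eq0 => /orP[/eqP ->|]; first by rewrite scale0r.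
by rewrite subr_eq0 => /eqP/embed_inj ->; rewrite subrr scaler0.
Qed.

Lemma extends_uniq v w z : extends v w -> extends v z -> w = z.
Proof.
move=> vw /(extends_scale (-1)); rewrite !scaleN1r => vz.
have := extends_add vw vz; rewrite subrr => /extends0 /eqP.
by rewrite subr_eq0 => /eqP.
Qed.

Lemma extends_total v : exists w, extends v w.
Proof.
have [c [x [y [c0 ->]]]] := wspace_spanned v.
by exists (c *: (g x - g y)), c, x, y.
Qed.

Lemma extends_embed x : extends (embed x) (g x).
Proof.
have g0 : g (wzero X) = 0.
  by rewrite -(wscale0l (wzero X)) gZ ?scale0r// lexx ler01.
by exists 1, x, (wzero X); rewrite embed0 g0 !subr0 !scale1r; split.
Qed.

Definition extension (v : V) : W := sval (cid (extends_total v)).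

Lemma extensionP v : extends v (extension v).
Proof. exact: (svalP (cid (extends_total v))). Qed.

Lemma extension_linear : linear extension.
Proof.
move=> a u v; apply: extends_uniq (extensionP _) _.
by apply: extends_add (extensionP _); exact/extends_scale/extensionP.
Qed.

Lemma extension_embed x : extension (embed x) = g x.
Proof. exact: extends_uniq (extensionP _) (extends_embed x). Qed.

End LinearExtension.

(** Positivity and decrease of the trace need checking on [X] only, as every vector of the cone is a
    nonnegative multiple of some [embed x]. *)
Lemma exists_hom (W : traced_space R) (g : X -> W) :
  (forall x y z, padd (wsum X) x y z -> g z = g x + g y) ->
  (forall r x, 0 <= r <= 1 -> g (wscale r x) = r *: g x) ->
  (forall x, pcone W (g x)) -> (forall x, trace (g x) <= wt x) ->
  exists f : sBBNS_hom V W, forall x, f (embed x) = g x.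
Proof.
move=> gD gZ g0 gw.
pose lin := GRing.isLinear.Build R V W _ (extension g) (extension_linear gD gZ).
pose f : {linear V -> W} := HB.pack (extension g) lin.
have fE x : f (embed x) = g x by exact: extension_embed.
have fv (v : V) : pcone V v -> exists c x, [/\ 0 <= c, v = c *: embed x & f v = c *: g x].
  move=> v0; have tv := trace_ge0 v0.
  have [c [c0 vc]] : exists c : R, 0 < c /\ trace v <= c.
    by exists (trace v + 1); split; lra.
  have [x ->] := pcone_embed v0 vc c0.
  by exists c, x; rewrite -fE linearZ; split=> //; exact: ltW.
have fp v : pcone V v -> pcone W (f v).
  by move=> /fv[c [x [c0 _ ->]]]; exact: pconeZ.
have fd v : pcone V v -> trace (f v) <= trace v.
  move=> /fv[c [x [c0 -> ->]]]; rewrite !linearZ /= trace_embed.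
  exact: ler_wpM2l.
by exists (SBBNSHom fp fd).
Qed.

End Extension.

Lemma vsum_map (R : realType) (V W : traced_space R) (f : sBBNS_hom V W)
    (J : countType) (x : J -> V) s : vsum x s -> vsum (fun j => f (x j)) (f s).
Proof.
move=> xs e e0; have [F Fs] := xs _ e0; exists F => G FG.
rewrite -linear_sum -linearB; apply: le_lt_trans (inorm_map _ _) _.
exact: Fs.
Qed.

(** * The functor *)

Section Clamp.
Variable R : realType.

Lemma zero_in01 : 0 <= (0 : R) <= 1. Proof. by rewrite lexx ler01. Qed.

(** Needed because [wscale] accepts every real. A real outside the unit interval is sent to 0, not
    to the nearest endpoint. *)
Definition clamp (r : R) : I01 R := insubd (exist _ 0 zero_in01 : I01 R) r.

Lemma val_clamp r : 0 <= r <= 1 -> val (clamp r) = r.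
Proof. by move=> r01; rewrite /clamp insubdK. Qed.

Lemma clampK (r : I01 R) : clamp (val r) = r.
Proof. by apply: val_inj; rewrite val_clamp//; exact: valP r. Qed.

End Clamp.

Lemma sigma_additive_padd (T U : Type) (M : sum_structure T) (N : sum_structure U)
    (f : T -> U) x y z : sigma_additive M N f -> padd M x y z -> padd N (f x) (f y) (f z).
Proof.
move=> fs /fs; suff -> : f \o pair_family x y = pair_family (f x) (f y) by [].
by apply: funext => -[].
Qed.

Lemma coproduct_ext (C : category) (J : countType) (B : J -> C) (S Y : C)
    (kappa : forall j, hom (B j) S) (f g : hom S Y) : is_coproduct kappa ->
  (forall j, f \oc kappa j = g \oc kappa j) -> f = g.
Proof.
move=> /(_ Y (fun j => f \oc kappa j))[h [_ hu]] fg.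
by rewrite -(hu f)// -(hu g).
Qed.

(** * Partial projections and the decomposition of the identity *)

Section PAC.
Variables (C : effectus_structure) (HC : is_sigmaPAC C).

Lemma comp_zeror (A B E : C) (g : hom B E) : g \oc zero_mor A B = zero_mor A E.
Proof.
have := pac_compl HC g (psum_empty (pac_sigmaPAM HC A B)).
move/(psum_uniq (pac_sigmaPAM HC A E)); apply.
exact: psum_void (pac_sigmaPAM HC A E) _ _ _.
Qed.

Lemma comp_zerol (A B E : C) (f : hom A B) : zero_mor B E \oc f = zero_mor A E.
Proof.
have := pac_compr HC f (psum_empty (pac_sigmaPAM HC B E)).
move/(psum_uniq (pac_sigmaPAM HC A E)); apply.
exact: psum_void (pac_sigmaPAM HC A E) _ _ _.
Qed.

Section Coproduct.
Variables (J : countType) (B : J -> C) (S : C) (kappa : forall j, hom (B j) S).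
Hypothesis kappaP : is_coproduct kappa.

(** The identity has type [hom (B k) (B i)] only after transport along a proof of [k = i]; this
    lemma hides the cast. *)
Lemma exists_kronecker i : exists d : forall k, hom (B k) (B i),
  d i = idc (B i) /\ forall k, k <> i -> d k = zero_mor (B k) (B i).
Proof.
exists (fun k => if pselect (k = i) is left e
  then ecast z (hom (B k) (B z)) e (idc (B k)) else zero_mor (B k) (B i)).
split; first by case: pselect => // e; rewrite (Prop_irrelevance e erefl).
by move=> k ki; case: pselect.
Qed.

Lemma exists_partial_projections :
  exists tri : forall j, hom S (B j), is_partial_projections kappa tri.
Proof.
have triP i : exists t : hom S (B i), t \oc kappa i = idc (B i) /\
    forall k, k <> i -> t \oc kappa k = zero_mor (B k) (B i).
  have [d [di dk]] := exists_kronecker i.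
  have [t [td _]] := kappaP d.
  by exists t; rewrite td di; split=> // k ki; rewrite td dk.
exists (fun i => sval (cid (triP i))).
split=> [i|i k]; first by have [] := svalP (cid (triP i)).
by have [_] := svalP (cid (triP i)); exact.
Qed.

End Coproduct.

(** Compatibility is witnessed in the copower [P] of [S]: the map [h] that sends the [j]-th summand
    through [kappa j] into the [j]-th copy of [S] has components [kappa j \oc tri j]. The resulting
    sum is the identity since after [kappa i] only the [i]-th term survives. *)
Lemma psum_id_coproduct (J : countType) (B : J -> C) (S : C)
    (kappa : forall j, hom (B j) S) (tri : forall j, hom S (B j)) :
  is_coproduct kappa -> is_partial_projections kappa tri ->
  psum (hom_sums S S) (fun j => kappa j \oc tri j) (idc S).
Proof.
move=> kappaP [tri1 tri0].
have [P [ii iiP]] := pac_coproducts HC (fun _ : J => S).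
have [tt [tt1 tt0]] := exists_partial_projections iiP.
have [h [hP _]] := kappaP P (fun j => ii j \oc kappa j).
have [e es] : psummable (hom_sums S S) (fun j => kappa j \oc tri j).
  apply: (pac_compatible_sum HC); exists P, ii, tt; split=> //; exists h => j.
  apply: (coproduct_ext kappaP) => i.
  rewrite -comp_assoc hP comp_assoc -[RHS]comp_assoc.
  have [->|/eqP ij] := eqVneq i j; first by rewrite tt1 tri1 comp_idl comp_idr.
  by rewrite tt0// tri0// comp_zerol comp_zeror.
suff -> : idc S = e by [].
apply: (coproduct_ext kappaP) => i; rewrite comp_idl.
have := pac_compr HC (kappa i) es.
apply: (psum_uniq (pac_sigmaPAM HC (B i) S)).
have := psum_single (pac_sigmaPAM HC (B i) S)
  (x := (fun g => g \oc kappa i) \o (fun j => kappa j \oc tri j)) (i := i).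
rewrite /= -comp_assoc tri1 comp_idr; apply=> j /nesym ij.
by rewrite -comp_assoc tri0// comp_zeror.
Qed.

End PAC.

Section Effectus.
Variables (R : realType) (C : effectus_structure) (HC : is_sigma_effectus C).
Variable phi : scalar_iso R C.
Hypothesis Hcanc : forall A : C, cancellative (hom_sums (@eunit C) A).
Let HP := eff_PAC HC.
Local Notation I := (@eunit C).
Local Notation sc a := (val (to01 phi a)).

Lemma scalar_ge0 a : 0 <= sc a. Proof. by case/andP: (valP (to01 phi a)). Qed.

Lemma scalar_le1 a : sc a <= 1. Proof. by case/andP: (valP (to01 phi a)). Qed.

Lemma scalar_inj a b : sc a = sc b -> a = b.
Proof. by move=> /val_inj/(can_inj (to01K phi)). Qed.

Lemma scalarK r : 0 <= r <= 1 -> sc (of01 phi (clamp r)) = r.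
Proof. by move=> r01; rewrite of01K val_clamp. Qed.

Lemma scalar0 : sc (zero_mor I I) = 0.
Proof.
have /(to01_add phi) := padd0 (pac_sigmaPAM HP I I) (zero_mor I I).
rewrite /zero_mor; lra.
Qed.

Lemma truth_unit : truth I = idc I.
Proof.
apply: scalar_inj; have := to01_mul phi (truth I) (idc I).
by rewrite comp_idr (to01_one phi) mul1r.
Qed.

Definition sweight (A : C) (omega : hom I A) : R := sc (truth A \oc omega).

(** The orthosupplement of [truth B \oc f] writes [truth A] as a sum; composed with [omega], its
    other summand is a nonnegative scalar. *)
Lemma sweight_comp (A B : C) (f : hom A B) omega :
  sweight (f \oc omega) <= sweight omega.
Proof.
have [a' [aa' _]] := ea_orthosupplement (eff_effect_algebra HC A) (truth B \oc f).
have := sigma_additive_padd (pac_compr HP omega) aa'.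
move=> /(to01_add phi); rewrite -comp_assoc /sweight => <-.
by rewrite lerDl scalar_ge0.
Qed.

Definition sscale (A : C) (r : R) (omega : hom I A) := omega \oc of01 phi (clamp r).

Section Substates.
Variable A : C.
Implicit Types x y z : hom I A.

Lemma sweight_add x y z : padd (hom_sums I A) x y z ->
  sweight z = sweight x + sweight y.
Proof.
by move=> /(sigma_additive_padd (pac_compl HP (truth A)))/(to01_add phi).
Qed.

Lemma sweight_perp x y : sweight x + sweight y <= 1 -> perp (hom_sums I A) x y.
Proof.
move=> le1; apply: (eff_perp HC).
exists (of01 phi (clamp (sweight x + sweight y))); apply/(to01_add phi).
by rewrite scalarK// le1 addr_ge0// scalar_ge0.
Qed.

Lemma sweight_eq0 x : sweight x = 0 -> x = zero_mor I A.
Proof.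
by move=> x0; apply: (eff_zero HC); apply: scalar_inj; rewrite scalar0.
Qed.

Lemma sweight_scale r x : 0 <= r <= 1 -> sweight (sscale r x) = r * sweight x.
Proof.
by move=> r01; rewrite /sweight /sscale comp_assoc to01_mul scalarK// mulrC.
Qed.

Lemma sscaleDr r x y z : 0 <= r <= 1 -> padd (hom_sums I A) x y z ->
  padd (hom_sums I A) (sscale r x) (sscale r y) (sscale r z).
Proof. by move=> _; exact: sigma_additive_padd (pac_compr HP _). Qed.

Lemma sscaleDl r s x : 0 <= r -> 0 <= s -> r + s <= 1 ->
  padd (hom_sums I A) (sscale r x) (sscale s x) (sscale (r + s) x).
Proof.
move=> r0 s0 rs; apply: sigma_additive_padd (pac_compl HP x) _.
by apply/(to01_add phi); rewrite !scalarK//; lra.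
Qed.

Lemma sscaleA r s x : 0 <= r <= 1 -> 0 <= s <= 1 ->
  sscale r (sscale s x) = sscale (r * s) x.
Proof.
move=> r01 s01; rewrite /sscale -comp_assoc; congr (_ \oc _).
have rs01 : 0 <= r * s <= 1.
  by move: r01 s01 => /andP[? ?] /andP[? ?]; rewrite mulr_ge0// mulr_ile1.
by apply: scalar_inj; rewrite to01_mul !scalarK// mulrC.
Qed.

Lemma sscale1 x : sscale 1 x = x.
Proof.
rewrite /sscale; suff -> : of01 phi (clamp 1) = idc I by rewrite comp_idr.
by apply: scalar_inj; rewrite -truth_unit (to01_one phi) scalarK// ler01 lexx.
Qed.

Definition substate_module : wmodule R :=
  @WModule R (hom I A) (hom_sums I A) (@sscale A) (@sweight A)
    (pac_sigmaPAM HP I A) (@Hcanc A) (fun=> scalar_ge0 _) (fun=> scalar_le1 _)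
    sweight_add sweight_perp sweight_eq0 sweight_scale sscaleDr sscaleDl
    sscaleA sscale1.

End Substates.

Lemma exists_fmap (A B : C) (f : hom A B) :
  exists F : sBBNS_hom (wspace (substate_module A)) (wspace (substate_module B)),
  forall x : substate_module A, F (embed x) = embed (f \oc x : substate_module B).
Proof.
apply: exists_hom.
- move=> x y z xyz; apply: embedD.
  exact: sigma_additive_padd (pac_compl HP f) xyz.
- move=> r x r01; rewrite -embedZ//; congr embed; exact: comp_assoc.
- by move=> x; exact: embed_cone.
- by move=> x; rewrite trace_embed; exact: sweight_comp.
Qed.

Definition Gobj (A : C) : sBBNS R := wspace_sBBNS (substate_module A).

Definition Gmap (A B : C) (f : hom A B) : hom (Gobj A) (Gobj B) :=
  sval (cid (exists_fmap f)).

Lemma GmapE (A B : C) (f : hom A B) (x : substate_module A) :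
  Gmap f (embed x) = embed (f \oc x : substate_module B).
Proof. exact: (svalP (cid (exists_fmap f))). Qed.

Lemma Gmap_id A : Gmap (idc A) = idc (Gobj A).
Proof. by apply: hom_ext => x; rewrite GmapE comp_idl. Qed.

Lemma Gmap_comp A B E (g : hom B E) (f : hom A B) : Gmap (g \oc f) = Gmap g \oc Gmap f.
Proof. by apply: hom_ext => x; rewrite /= !GmapE comp_assoc. Qed.

Definition G : functor C (sBBNS R) := Functor Gmap_id Gmap_comp.

(** As [embed] is injective, [fmap G f] determines the action of [f] on substates, in particular on
    states. *)
Lemma G_faithful : state_separated C -> faithful G.
Proof.
move=> Hsep A B f g fg; apply: Hsep => omega _.
apply: (@embed_inj R (substate_module B)).
by rewrite -!GmapE -[Gmap f]/(fmap G f) fg.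
Qed.

Lemma G_iso (A : C) : weight_iso (substates phi A) (subbase_module (G A)).
Proof.
pose X := substate_module A.
pose h (x : hom I A) : subbase (G A) :=
  exist (fun v => v \in subbase (wspace X)) (embed (x : X)) (mem_set (embed_subbase (x : X))).
have hI : injective h by move=> x y /(congr1 val)/(@embed_inj R X).
have hS v : exists x, h x = v.
  case: v => v vB; have [x xv] := embed_surj (set_mem vB).
  by exists x; apply: val_inj.
have [g gh] := choice hS.
exists h; split.
- by exists g => // x; apply: hI; rewrite gh.
- by move=> J x s; exact: (psum_embed (X := X)).
- move=> r x; apply: val_inj => /=.
  rewrite -(@embedZ R X)//; last exact: valP r.
  by congr embed; rewrite /= /sscale clampK.
- by move=> x; apply: val_inj; rewrite /= trace_embed.
Qed.

Definition line (V : traced_space R) (v : V) : real_traced R -> V :=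
  fun r => (r : R) *: v.

Lemma line_linear (V : traced_space R) (v : V) : linear (line v).
Proof. by move=> a r s; rewrite /line scalerDl scalerA. Qed.

HB.instance Definition _ (V : traced_space R) (v : V) :=
  GRing.isLinear.Build R (real_traced R) V _ (line v) (line_linear v).

Lemma line_pos (V : traced_space R) (v : V) (r : real_traced R) :
  pcone V v -> pcone (real_traced R) r -> pcone V (line v r).
Proof. by move=> v0 r0; exact: pconeZ. Qed.

Lemma line_decr (V : traced_space R) (v : V) (r : real_traced R) :
  trace v <= 1 -> pcone (real_traced R) r -> trace (line v r) <= trace r.
Proof. by move=> v1 r0; rewrite /line linearZ /=; exact: ler_piMr. Qed.

Definition unit_embed : wspace (substate_module I) := embed (idc I : substate_module I).

Definition Gunit : hom (@eunit (sBBNS R)) (G I) :=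
  @SBBNSHom R (real_traced R) _ (line unit_embed)
    (fun r => line_pos (embed_cone _))
    (fun r => line_decr (embed_subbase (idc I : substate_module I)).2).

(** The scalar [truth A \oc x] is the identity scaled by the weight of [x], so both sides send
    [embed x] to that multiple of [unit_embed]. *)
Lemma G_truth (A : C) : fmap G (truth A) = Gunit \oc truth (G A).
Proof.
apply: hom_ext => x; rewrite [LHS]GmapE.
rewrite [RHS](_ : _ = trace (embed x) *: unit_embed)//.
have w01 : 0 <= wt x <= 1 by rewrite wt_ge0 wt_le1.
rewrite trace_embed -embedZ//; congr embed.
rewrite /= /sscale comp_idl; apply: scalar_inj.
by rewrite scalarK//.
Qed.

Lemma Gunit_iso : is_iso Gunit.
Proof.
exists (truth (G I)).
  apply: sBBNS_homP => r.
  rewrite [LHS](_ : _ = trace ((r : R) *: unit_embed))//.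
  rewrite linearZ /= /unit_embed trace_embed [wt _](_ : _ = 1) ?[LHS]mulr1//.
  by rewrite /= /sweight comp_idr (to01_one phi).
(* The other composite is the image under [G] of [truth I], which is the identity. *)
by rewrite -G_truth truth_unit; exact: Gmap_id.
Qed.

(** * Preservation of countable coproducts *)

Section PreservesCoproducts.
Variables (J : countType) (B : J -> C) (S : C) (kappa : forall j, hom (B j) S).
Hypothesis kappaP : is_coproduct kappa.
Variables (tri : forall j, hom S (B j)).
Hypothesis triP : is_partial_projections kappa tri.
Local Notation "'St' A" := (substate_module A) (at level 10, A at level 9).

Lemma psum_substate (omega : hom I S) :
  psum (hom_sums I S) (fun j => kappa j \oc (tri j \oc omega)) omega.
Proof.
have := pac_compr HP omega (psum_id_coproduct HP kappaP triP).
rewrite comp_idl; suff -> : (fun g => g \oc omega) \o (fun j => kappa j \oc tri j) =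
  (fun j => kappa j \oc (tri j \oc omega)) by [].
by apply: funext => j; rewrite /= comp_assoc.
Qed.

(** Neither [kappa j] nor its left inverse [tri j] can raise a weight. *)
Lemma sweight_coprojection j (omega : hom I (B j)) :
  sweight (kappa j \oc omega) = sweight omega.
Proof.
apply/eqP; rewrite eq_le sweight_comp /=.
rewrite -{1}[omega]comp_idl -(proj1 triP) -comp_assoc.
exact: sweight_comp.
Qed.

Section Cotuple.
Variables (W : sBBNS_obj R) (f : forall j, sBBNS_hom (wspace (St (B j))) W).

Let term (omega : hom I S) j : W := f j (embed (tri j \oc omega : St (B j))).

Lemma sum_trace_term omega (F : {fset J}) :
  \sum_(j <- F) trace (term omega j) <= sweight omega.
Proof.
apply: le_trans (psum_weight_ge (wmod_PAM (St S)) (@wt_ge0 _ (St S))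
  (@wt_add _ (St S)) F (psum_substate omega)).
apply: ler_sum => j _; rewrite /= sweight_coprojection.
by apply: le_trans (bbns_decr _ (embed_cone _)) _; rewrite trace_embed.
Qed.

Lemma exists_term_sum omega : exists s, subbase W s /\ vsum (term omega) s.
Proof.
have [||s sW ts] := @vsum_exists R W (@bbns_closed R W) J (term omega).
- by move=> j; apply: bbns_pos; exact: embed_cone.
- by move=> F; apply: le_trans (sum_trace_term omega F) _; exact: scalar_le1.
by exists s.
Qed.

(** Additivity and homogeneity of the sum of the terms follow from uniqueness of limits. The trace
    bound holds for finite partial sums because the weights of the components of [omega] add up to
    at most its own, and it passes to the limit. *)
Lemma exists_cotuple : exists g : sBBNS_hom (wspace (St S)) W,
  forall omega : St S, vsum (term omega) (g (embed omega)).
Proof.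
have [s sP] := choice exists_term_sum.
have [||||g gE] := @exists_hom R (St S) W s.
- move=> x y z xyz; apply: (vsum_uniq (bbns_banach W).1 (sP z).2).
  have := vsumD (sP x).2 (sP y).2.
  suff -> : (fun j => term x j + term y j) = term z by [].
  apply: funext => j; rewrite /term -linearD; congr (f j _); symmetry.
  by apply: embedD; exact: sigma_additive_padd (pac_compl HP (tri j)) xyz.
- move=> r x r01; apply: (vsum_uniq (bbns_banach W).1 (sP _).2).
  have r0 : 0 <= r by case/andP: r01.
  have := vsumZ r0 (sP x).2.
  suff -> : (fun j => r *: term x j) = term (wscale r x) by [].
  apply: funext => j; rewrite /term -linearZ -(embedZ _ r01); congr (f j (embed _)).
  by rewrite /= /sscale comp_assoc.
- by move=> x; have [[]] := sP x.
- by move=> x; apply: vsum_trace_le (sP x).2 _; exact: sum_trace_term.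
by exists g => omega; rewrite gE; exact: (sP omega).2.
Qed.

End Cotuple.

(** On the image of [kappa i] only the [i]-th term of the cotuple is nonzero. Any other mediating
    [h] is contractive, so it commutes with the convergent decomposition of [omega] and has the same
    value. *)
Lemma G_coproduct : is_coproduct (B := fun j => G (B j)) (fun j => fmap G (kappa j)).
Proof.
move=> W f; have [g gP] := @exists_cotuple W f.
exists g; split=> [i|h hP].
  apply: hom_ext => y; rewrite [LHS](_ : _ = g (Gmap (kappa i) (embed y)))//.
  rewrite GmapE; apply: (vsum_uniq (bbns_banach W).1 (gP _)).
  have := @vsum_single _ W J (fun j => f j (embed (tri j \oc (kappa i \oc y) : St (B j)))) i.
  rewrite [X in vsum _ X](_ : _ = f i (embed y)); last first.
    by rewrite comp_assoc (proj1 triP) comp_idl.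
  apply=> j /nesym ij; rewrite comp_assoc (proj2 triP)// (comp_zerol HP).
  by rewrite [embed _](@embed0 R (St (B j))) linear0.
apply: hom_ext => omega; apply: (vsum_uniq (bbns_banach W).1 (gP omega)).
have := vsum_map h (@embed_vsum R (St S) _ _ _ (psum_substate omega)).
suff -> : (fun j => h (embed (kappa j \oc (tri j \oc omega) : St S))) =
  (fun j => f j (embed (tri j \oc omega : St (B j)))) by [].
apply: funext => j; rewrite -hP.
rewrite [RHS](_ : _ = h (Gmap (kappa j) (embed (tri j \oc omega : St (B j)))))//.
by rewrite GmapE.
Qed.

End PreservesCoproducts.

Lemma G_morphism : is_effectus_morphism G.
Proof.
split=> [J B S kappa kappaP|].
  have [tri triP] := exists_partial_projections kappaP.
  exact: (G_coproduct kappaP triP).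
by exists Gunit; split; [exact: Gunit_iso | exact: G_truth].
Qed.

End Effectus.

Theorem theorem60 (R : realType) (C : effectus_structure)
    (HC : is_sigma_effectus C)
    (phi : scalar_iso R C)
    (Hsep : state_separated C)
    (Hcanc : forall A : C, cancellative (hom_sums (@eunit C) A)) :
  exists G : functor C (sBBNS R),
    is_effectus_morphism G /\
    faithful G /\
    forall A : C,
      weight_iso (substates phi A) (subbase_module (G A)).
Proof.
exists (G HC phi Hcanc); split; first exact: G_morphism.
by split; [exact: G_faithful | exact: G_iso].
Qed.
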